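(* Let $k$ be an $F$-finite field of characteristic $p>0$, let $R=k[x_1,\dots,x_n]/I$ be a quotient of a polynomial ring, let $\mathcal{C}$ be an $R$-Cartier algebra and $M$ a coherent left $\mathcal{C}$-module such that the pair $(M,\mathcal{C})$ is gauge bounded. Let $\mathfrak{a}\subseteq R$ be an ideal and $T$ a positive real number. Then the set of test modules $\{\tau(M,\mathcal{C},\mathfrak{a}^t) : 0\le t\le T\}$ is a finite set. Similarly, if $k$ is an $F$-finite field of characteristic $p>0$, $R=k[x_1,\dots,x_n]/I$, $\mathcal{C}$ is an $R$-Cartier algebra, $M$ is a coherent left $\mathcal{C}$-module such that the pair $(M,\mathcal{C})$ is gauge bounded, $\mathfrak{a}\subseteq R$ is an ideal and $T$ is a positive real number, then the set $\{\underline{M}_{\mathcal{C}^{\mathfrak{a}^t}} : 0\le t\le T\}$ of $F$-pure submodules of $M$ is a finite set.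
   Context: A field $k$ of characteristic $p$ is $F$-finite if $[k:k^p]<\infty$. $R$-Cartier algebra: an $\mathbb{N}$-graded (generally non-commutative) ring $\mathcal{C}=\bigoplus_{e\ge 0}\mathcal{C}_e$ with a ring homomorphism $R\to\mathcal{C}$ whose image is $\mathcal{C}_0$, such that $r\cdot\phi=\phi\cdot r^{p^e}$ for all $r\in R$, $\phi\in\mathcal{C}_e$. Every left $\mathcal{C}$-module $M$ is an $R$-module via $R\to\mathcal{C}_0$; it is coherent if finitely generated over $R$. Put $\mathcal{C}_+=\bigoplus_{e\ge1}\mathcal{C}_e$ and let $\mathcal{C}_+^nM$ be the $\mathcal{C}$-submodule of $M$ generated by all $\phi_1\cdots\phi_n m$ with $\phi_i\in\mathcal{C}_+$, $m\in M$. $M$ is $F$-pure if $\mathcal{C}_+M=M$. For coherent $M$ the chain $M\supseteq\mathcal{C}_+M\supseteq\mathcal{C}_+^2M\supseteq\cdots$ stabilizes, and its stable member $\underline{M}_{\mathcal{C}}$ is the largest $F$-pure $\mathcal{C}$-submodule of $M$. Test module: $\tau(M,\mathcal{C})$ is the smallest $\mathcal{C}$-submodule $N\subseteq M$ such that $N_\eta=(\underline{M}_{\mathcal{C}})_\eta$ for each generic point $\eta$ of an irreducible component of $\operatorname{Supp}\underline{M}_{\mathcal{C}}$; in the present setting ($R$ of finite type over an $F$-finite field) it always exists. For an ideal $\mathfrak{a}$ and real $t\ge0$, $\mathcal{C}^{\mathfrak{a}^t}\subseteq\mathcal{C}$ is the $R$-Cartier algebra with $(\mathcal{C}^{\mathfrak{a}^t})_e=\mathcal{C}_e\cdot\mathfrak{a}^{\lceil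 t(p^e-1)\rceil}$, and $\tau(M,\mathcal{C},\mathfrak{a}^t):=\tau(M,\mathcal{C}^{\mathfrak{a}^t})$. Gauges: let $S=k[x_1,\dots,x_n]$ and, for $d\ge0$, let $S_d$ be the $k$-span of the monomials $x_1^{i_1}\cdots x_n^{i_n}$ with $\max_j i_j\le d$. Given $R$-module generators $m_1,\dots,m_l$ of $M$, put $M_{-\infty}=0$ and $M_d=S_dm_1+\dots+S_dm_l$ for $d\ge 0$. The associated gauge $\delta:M\to\{-\infty\}\cup\mathbb{N}$ sends $m$ to the least $d\in\{-\infty\}\cup\mathbb{N}$ with $m\in M_d$. The pair $(M,\mathcal{C})$ is gauge bounded if for some (equivalently each) gauge $\delta$ on $M$ there exist a set $\{\psi_i\in\mathcal{C}_{e_i}, e_i\ge1\}_{i\in J}$ generating $\mathcal{C}_+$ as a right $R$-module and a constant $K$ such that $\delta(\psi_i(m))\le\frac{\delta(m)}{p^{e_i}}+\frac{K}{p-1}$ for all $i\in J$ and $m\in M$. *)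

(* Defs.v *)
(* The notations of mpoly clash with those of constructive_ereal;
   mpoly n k is the polynomial ring {mpoly k[n]}. *)
From HB Require Import structures.
From mathcomp Require Import all_boot all_order all_algebra.
From mathcomp Require Import -(notations) mpoly.
From mathcomp Require Import boolp classical_sets cardinality reals.
From mathcomp Require Import constructive_ereal.

Set Implicit Arguments.
Unset Strict Implicit.
Unset Printing Implicit Defensive.

Import Order.TTheory GRing.Theory Num.Theory.
Local Open Scope classical_set_scope.
Local Open Scope ring_scope.

Definition F_finite (k : fieldType) (p : nat) : Prop :=
  exists (l : nat) (b : 'I_l -> k),
    forall x : k, exists c : 'I_l -> k, x = \sum_(i < l) c i ^+ p * b i.

Definition is_subgroup (V : zmodType) (A : set V) : Prop :=
  A 0 /\ forall x y, A x -> A y -> A (x - y).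

Definition is_ideal (R : comPzRingType) (I : set R) : Prop :=
  is_subgroup I /\ forall r x, I x -> I (r * x).

(* For m = 0 the only product is the empty one, so the power is the unit ideal,
   also when a = 0. *)
Definition ideal_pow (R : comPzRingType) (a : set R) (m : nat) : set R :=
  smallest (@is_ideal R)
    [set \prod_(i < m) f i | f in [set f : 'I_m -> R | forall i, a (f i)]].

(* A Cartier algebra is a ring C with homogeneous pieces
    G e and structure map iota : R -> C.  A graded Cartier subalgebra of C is
    represented by the family of its pieces D e, subsets of G e. *)

Record is_grading (C : pzRingType) (G : nat -> set C) : Prop := IsGrading {
  grading_subgroup : forall e, is_subgroup (G e);
  grading_one : G 0%N 1;
  grading_mul : forall d e x y, G d x -> G e y -> G (d + e)%N (x * y);
  grading_span : forall c, exists (N : nat) (f : nat -> C),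
    (forall e, G e (f e)) /\ c = \sum_(e < N) f e;
  grading_direct : forall (N : nat) (f : nat -> C), (forall e, G e (f e)) ->
    \sum_(e < N) f e = 0 -> forall e, (e < N)%N -> f e = 0
}.

Record is_cartier_algebra (p : nat) (R : comPzRingType) (C : pzRingType)
    (iota : {rmorphism R -> C}) (G : nat -> set C) : Prop := IsCartierAlgebra {
  cartier_grading : is_grading G;
  cartier_zero : G 0%N = range iota;
  cartier_linear : forall e r phi, G e phi ->
    iota r * phi = phi * iota (r ^+ (p ^ e)%N)
}.

Definition alg_total (C : pzRingType) (D : nat -> set C) : set C :=
  smallest (@is_subgroup C) (\bigcup_(e in [set: nat]) D e).

Definition alg_plus (C : pzRingType) (D : nat -> set C) : set C :=
  smallest (@is_subgroup C) (\bigcup_(e in [set e | (1 <= e)%N]) D e).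

(* The pieces C_e a^ceil(t (p^e - 1)) of the Cartier subalgebra C^(a^t). *)
Definition twist (RR : realType) (p : nat) (R : comPzRingType) (C : pzRingType)
    (iota : {rmorphism R -> C}) (G : nat -> set C) (a : set R) (t : RR) :
    nat -> set C :=
  fun e => smallest (@is_subgroup C)
    [set phi * iota r | phi in G e &
                        r in ideal_pow a `|Num.ceil (t * (p ^ e - 1)%:R)|%N].

(* The R-action on a left C-module is r.m = iota r *: m. *)

Definition coherent (R : comPzRingType) (C : pzRingType)
    (iota : {rmorphism R -> C}) (M : lmodType C) : Prop :=
  exists (l : nat) (g : 'I_l -> M),
    forall m : M, exists r : 'I_l -> R, m = \sum_(i < l) iota (r i) *: g i.

Definition is_submod (C : pzRingType) (M : lmodType C) (D : nat -> set C)
    (N : set M) : Prop :=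
  is_subgroup N /\ forall c x, alg_total D c -> N x -> N (c *: x).

Definition plus_pow (C : pzRingType) (M : lmodType C) (D : nat -> set C)
    (n : nat) : set M :=
  smallest (is_submod D)
    [set x | exists (phi : 'I_n -> C) (m : M),
      (forall i, alg_plus D (phi i)) /\ x = (\prod_(i < n) phi i) *: m].

Arguments plus_pow {C} M D n.

(* The stable member of the chain plus_pow; the empty set if the chain did not
   stabilize. *)
Definition underline (C : pzRingType) (M : lmodType C) (D : nat -> set C) :
    set M :=
  [set x | exists2 n : nat,
     forall n', (n <= n')%N -> plus_pow M D n' = plus_pow M D n &
     plus_pow M D n x].

Arguments underline {C} M D.

(* Points of Spec R are subsets of R. *)

Definition is_prime (R : comPzRingType) (P : set R) : Prop :=
  [/\ is_ideal P, ~ P 1 & forall x y, P (x * y) -> P x \/ P y].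

Definition zariski_closed (R : comPzRingType) (Z : set (set R)) : Prop :=
  exists E : set R, Z = [set P | is_prime P /\ E `<=` P].

Definition irreducible (R : comPzRingType) (Y : set (set R)) : Prop :=
  Y !=set0 /\ forall A B, zariski_closed A -> zariski_closed B ->
    Y `<=` A `|` B -> Y `<=` A \/ Y `<=` B.

Definition irreducible_component (R : comPzRingType) (Z Y : set (set R)) :
    Prop :=
  [/\ Y `<=` Z, irreducible Y &
      forall Y', irreducible Y' -> Y' `<=` Z -> Y `<=` Y' -> Y' = Y].

Definition generic_point (R : comPzRingType) (Y : set (set R)) (P : set R) :
    Prop :=
  is_prime P /\ Y = smallest (@zariski_closed R) [set P].

(* A pair (x, s) with s outside P stands for the fraction x / s in M_P. *)
Definition frac_eq (R : comPzRingType) (C : pzRingType)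
    (iota : {rmorphism R -> C}) (M : lmodType C) (P : set R) (u v : M * R) :
    Prop :=
  exists w : R, ~ P w /\
    iota (w * v.2) *: u.1 = iota (w * u.2) *: v.1.

(* N_P inside M_P, as a set of fractions saturated for frac_eq. *)
Definition localize (R : comPzRingType) (C : pzRingType)
    (iota : {rmorphism R -> C}) (M : lmodType C) (P : set R) (N : set M) :
    set (M * R) :=
  [set u | ~ P u.2 /\
     exists x s, [/\ N x, ~ P s & frac_eq iota P u (x, s)]].

Definition module_support (R : comPzRingType) (C : pzRingType)
    (iota : {rmorphism R -> C}) (M : lmodType C) (N : set M) : set (set R) :=
  [set P | is_prime P /\
     exists2 u, localize iota P N u & ~ frac_eq iota P u (0, 1)].

Definition generically_equal (R : comPzRingType) (C : pzRingType)
    (iota : {rmorphism R -> C}) (M : lmodType C) (D : nat -> set C)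
    (N : set M) : Prop :=
  forall Y eta,
    irreducible_component (module_support iota (underline M D)) Y ->
    generic_point Y eta ->
    localize iota eta N = localize iota eta (underline M D).

Definition is_test_module (R : comPzRingType) (C : pzRingType)
    (iota : {rmorphism R -> C}) (M : lmodType C) (D : nat -> set C)
    (N : set M) : Prop :=
  [/\ is_submod D N, generically_equal iota D N &
      forall N', is_submod D N' -> generically_equal iota D N' -> N `<=` N'].

(* The smallest submodule above; the empty set if there were none. *)
Definition test_module (R : comPzRingType) (C : pzRingType)
    (iota : {rmorphism R -> C}) (M : lmodType C) (D : nat -> set C) : set M :=
  [set x | exists2 N, is_test_module iota D N & N x].

Arguments test_module {R C} iota M D.

Lemma test_moduleE (R : comPzRingType) (C : pzRingType)
    (iota : {rmorphism R -> C}) (M : lmodType C) (D : nat -> set C)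
    (N : set M) :
  is_test_module iota D N -> test_module iota M D = N.
Proof.
move=> hN; have [hs hg _] := hN.
apply/seteqP; split=> x; last by exists N.
by case=> N' [_ _ hmin] N'x; apply: hmin N'x.
Qed.

Lemma underlineE (C : pzRingType) (M : lmodType C) (D : nat -> set C) n :
  (forall n', (n <= n')%N -> plus_pow M D n' = plus_pow M D n) ->
  underline M D = plus_pow M D n.
Proof.
move=> hn; apply/seteqP; split=> x; last by exists n.
case=> m hm; rewrite -(hm (maxn m n)) ?leq_maxl //.
by rewrite (hn (maxn m n)) ?leq_maxr.
Qed.

(* The k-span of the monomials with all exponents at most d: a polynomial lies
   in the span iff every monomial of its support does. *)
Definition box (k : fieldType) (n d : nat) : set (mpoly n k) :=
  [set f | forall m : multinom n, m \in msupp f ->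
     (\max_(j < n) m j <= d)%N].

(* Degrees in {-oo} u N are elements of option nat, None being -oo. *)
Definition degR (RR : realType) (d : option nat) : \bar RR :=
  if d is Some d' then (d'%:R)%:E else -oo%E.

Definition gauge_level (k : fieldType) (n : nat) (R : comPzRingType)
    (C : pzRingType) (pi : {rmorphism mpoly n k -> R})
    (iota : {rmorphism R -> C}) (M : lmodType C) (l : nat) (g : 'I_l -> M)
    (d : option nat) : set M :=
  if d is Some d' then
    [set m | exists f : 'I_l -> mpoly n k,
       (forall i, box d' (f i)) /\
       m = \sum_(i < l) iota (pi (f i)) *: g i]
  else [set 0].

Definition is_gauge (RR : realType) (k : fieldType) (n : nat)
    (R : comPzRingType) (C : pzRingType)
    (pi : {rmorphism mpoly n k -> R}) (iota : {rmorphism R -> C})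
    (M : lmodType C) (l : nat) (g : 'I_l -> M) (delta : M -> option nat) :
    Prop :=
  forall m : M, gauge_level pi iota g (delta m) m /\
    forall d, gauge_level pi iota g d m ->
      (degR RR (delta m) <= degR RR d)%E.

Definition gauge_bounded (RR : realType) (p : nat) (k : fieldType) (n : nat)
    (R : comPzRingType) (C : pzRingType)
    (pi : {rmorphism mpoly n k -> R}) (iota : {rmorphism R -> C})
    (G : nat -> set C) (M : lmodType C) : Prop :=
  exists (l : nat) (g : 'I_l -> M) (delta : M -> option nat),
  [/\ forall m : M, exists r : 'I_l -> R, m = \sum_(i < l) iota (r i) *: g i,
      is_gauge RR pi iota g delta &
  exists (J : Type) (e : J -> nat) (psi : J -> C) (K : RR),
  [/\ forall i, (1 <= e i)%N /\ G (e i) (psi i),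
      forall c, alg_plus G c ->
        exists s : seq (J * R), c = \sum_(x <- s) psi x.1 * iota x.2 &
      forall i m,
        (degR RR (delta (psi i *: m)) <=
           degR RR (delta m) * ((p ^ e i)%:R^-1)%:E + (K / (p.-1)%:R)%:E)%E]].

(* Main.v *)
(* A Cartier module N over C^(a^t) with C_+ N = N is generated over R by its
   elements of gauge at most a bound D that depends only on T. Indeed N is
   finitely generated, hence generated by elements of gauge at most some B;
   writing polynomials as sums of s^(p^e) u with all exponents of u below p^e
   and using h s^(p^e) = s h for h of degree e, one sees that N is also
   generated by elements of gauge at most B/p^e + K' for a constant K'
   independent of N, and this can be iterated. Both the F-pure submodules and
   the test modules satisfy C_+ N = N and, for t > 0, decrease with t. So each
   family is a chain of submodules, each determined by a subspace of the
   finite-dimensional k-space of elements of gauge at most D. For the test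
   modules monotonicity holds because, for t > 0, the generic points of the
   support lie outside V(a), where the exponent t plays no role; t = 0 is a
   single value and is left aside. *)
Require Import Defs.
From mathcomp Require Import all_boot all_order all_algebra.
From mathcomp Require Import -(notations) mpoly.
From mathcomp Require Import boolp classical_sets cardinality reals.
From mathcomp Require Import constructive_ereal.

Set Implicit Arguments.
Unset Strict Implicit.
Unset Printing Implicit Defensive.

Import Order.TTheory GRing.Theory Num.Theory.
Local Open Scope classical_set_scope.
Local Open Scope ring_scope.

(** Values of t at which the chain [plus_pow] does not stabilize, or at which there is no smallest
    submodule, are covered by the defaults in the definitions: they contribute only the empty set
    and the zero module. The remaining t > 0 are compared by inclusion.

    The bound is uniform in t because both sources of growth are proportional to p^e before a map of
    degree e divides by p^e. The ideal a^ceil(t (p^e - 1)) is generated by elements of gauge at most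
    c T1 (p^e - 1), where c bounds generators of a and T1 >= T is an integer, and the remainder u
    has gauge below p^e. With K the additive constant of the maps, K' becomes 1 + c T1 + K, and
    iterating B -> B/2 + K' leads to D = 2 K'. As s^(p^e) passes only maps of degree exactly e,
    generators of C_+ are first sorted by degree.

    For test modules at t <= t', two supports have to be matched: a power of some f in a outside eta
    carries the larger stable module into the smaller one, so the two agree near eta. *)

Section Subgroups.
Context {V : zmodType}.
Implicit Types A B : set V.

Lemma subgroup0 A : is_subgroup A -> A 0.
Proof. by case. Qed.

Lemma subgroupB A x y : is_subgroup A -> A x -> A y -> A (x - y).
Proof. by case=> _; apply. Qed.

Lemma subgroupN A x : is_subgroup A -> A x -> A (- x).
Proof. by move=> hA Ax; rewrite -sub0r; apply: subgroupB => //; case: hA. Qed.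

Lemma subgroupD A x y : is_subgroup A -> A x -> A y -> A (x + y).
Proof.
by move=> hA Ax Ay; rewrite -[y]opprK; apply: subgroupB => //; apply: subgroupN.
Qed.

Lemma subgroup_sum (I : Type) (r : seq I) (P : pred I) (F : I -> V) A :
  is_subgroup A -> (forall i, P i -> A (F i)) -> A (\sum_(i <- r | P i) F i).
Proof.
move=> hA hF; apply: (big_ind A) => //; first exact: subgroup0.
by move=> x y; apply: subgroupD.
Qed.

Lemma subgroupI A B : is_subgroup A -> is_subgroup B -> is_subgroup (A `&` B).
Proof.
by move=> [A0 hA] [B0 hB]; split=> // x y [? ?] [? ?]; split;
  [apply: hA|apply: hB].
Qed.

Lemma smallest_subgroup A : is_subgroup (smallest (@is_subgroup V) A).
Proof.
split=> [B [[]]//|x y hx hy B hB]; apply: subgroupB;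
  [by case: hB|exact: hx|exact: hy].
Qed.

End Subgroups.

Lemma preim_subgroup (V W : zmodType) (f : V -> W) (A : set W) :
  (forall x y, f (x - y) = f x - f y) -> is_subgroup A ->
  is_subgroup (f @^-1` A).
Proof.
move=> fB [A0 AB]; split=> [|x y fx fy]; rewrite /preimage /=;
  last by rewrite fB; apply: AB.
by rewrite -(subrr 0) fB subrr.
Qed.

(** * Modules given by an action, and Noetherian rings *)

(** An explicit action rather than an [lmodType]: the same lemmas then serve M over R through
    [iota], M over k through constant polynomials, a ring over itself, and polynomials over their
    coefficients. *)
Definition is_action (R : comPzRingType) (V : zmodType) (act : R -> V -> V) :=
  [/\ forall r x y, act r (x - y) = act r x - act r y,
      forall r s x, act (r - s) x = act r x - act s x,
      forall r s x, act (r * s) x = act r (act s x) &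
      forall x, act 1 x = x].

Definition act_closed (R : comPzRingType) (V : zmodType) (act : R -> V -> V)
    (N : set V) :=
  is_subgroup N /\ forall r x, N x -> N (act r x).

Definition act_span (R : comPzRingType) (V : zmodType) (act : R -> V -> V)
    (A : set V) :=
  smallest (act_closed act) A.

Definition noetherian (R : comPzRingType) :=
  forall I : set R, is_ideal I ->
    exists s : seq R, I = act_span *%R [set x | x \in s].

Section Actions.
Context {R : comPzRingType} {V : zmodType} {act : R -> V -> V}.
Hypothesis hact : is_action act.
Implicit Types A N Q : set V.

Lemma actB r x y : act r (x - y) = act r x - act r y.
Proof. by case: hact. Qed.
Lemma actBl r s x : act (r - s) x = act r x - act s x.
Proof. by case: hact. Qed.
Lemma actM r s x : act (r * s) x = act r (act s x).
Proof. by case: hact. Qed.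
Lemma act1 x : act 1 x = x.
Proof. by case: hact. Qed.
Lemma actr0 r : act r 0 = 0.
Proof. by have := actB r 0 0; rewrite !subrr. Qed.
Lemma act0r x : act 0 x = 0.
Proof. by have := actBl 0 0 x; rewrite !subrr. Qed.

Lemma actN r x : act r (- x) = - act r x.
Proof. by rewrite -sub0r actB actr0 sub0r. Qed.
Lemma actD r x y : act r (x + y) = act r x + act r y.
Proof. by rewrite -[y]opprK actB !actN !opprK. Qed.

Lemma act_closedI N Q :
  act_closed act N -> act_closed act Q -> act_closed act (N `&` Q).
Proof.
move=> [hN aN] [hQ aQ]; split; first exact: subgroupI.
by move=> r x [? ?]; split; [apply: aN|apply: aQ].
Qed.

Lemma act_closed0 : act_closed act [set 0].
Proof.
split; first by split=> // x y -> ->; rewrite subr0.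
by move=> r x ->; apply: actr0.
Qed.

Lemma act_closed_preim r N : act_closed act N -> act_closed act (act r @^-1` N).
Proof.
move=> [hN aN]; split; first by apply: preim_subgroup => //; apply: actB.
by move=> s x; rewrite /preimage /= -actM mulrC actM; apply: aN.
Qed.

Lemma act_span_closed A : act_closed act (act_span act A).
Proof.
split; first split.
- by move=> B [[[B0 _] _] _].
- move=> x y hx hy B hB; apply: subgroupB; first by case: hB => -[].
    exact: hx.
  exact: hy.
- move=> r x hx B hB; have [[_ +] _] := hB; apply; exact: hx.
Qed.

Lemma act_span_incl A x : A x -> act_span act A x.
Proof. by move=> Ax B [_]; apply. Qed.

Lemma act_span_min A Q : act_closed act Q -> A `<=` Q -> act_span act A `<=` Q.
Proof. by move=> hQ AQ; apply: smallest_sub. Qed.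

Lemma act_spanS A B : A `<=` B -> act_span act A `<=` act_span act B.
Proof.
move=> AB; apply: act_span_min; first exact: act_span_closed.
by move=> x /AB; apply: act_span_incl.
Qed.

Lemma act_span_cons g (s : seq V) x :
  act_span act [set y | y \in g :: s] x ->
  exists r, exists2 y, act_span act [set y | y \in s] y & x = act r g + y.
Proof.
have [[h0 hB] hZ] := act_span_closed [set y | y \in s].
pose Q := [set x | exists r, exists2 y,
  act_span act [set y | y \in s] y & x = act r g + y].
suff : act_span act [set y | y \in g :: s] `<=` Q by apply.
apply: act_span_min => {x}.
  split; first split.
  - by exists 0, 0; rewrite ?act0r ?addr0.
  - move=> _ _ [r [y hy ->]] [r' [y' hy' ->]].
    exists (r - r'), (y - y'); first exact: hB.
    by rewrite actBl addrACA -opprD.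
  - move=> t _ [r [y hy ->]]; exists (t * r), (act t y); first exact: hZ.
    by rewrite actD actM.
move=> x /=; rewrite in_cons => /orP[/eqP ->|xs].
  by exists 1, 0; rewrite ?act1 ?addr0.
by exists 0, x; [apply: act_span_incl|rewrite act0r add0r].
Qed.

End Actions.

Lemma action_scale (R : comPzRingType) (V : lmodType R) :
  is_action (@GRing.scale R V).
Proof. by split=> *; rewrite ?scalerBr ?scalerBl ?scalerA ?scale1r. Qed.

(** Induction on s: the coefficients of g in elements of N form an ideal; lifts of its generators,
    together with generators of the part of N in the span of the remaining elements, generate N. *)
Lemma noetherian_submodule (R : comPzRingType) (V : zmodType)
    (act : R -> V -> V) (s : seq V) (N : set V) :
  noetherian R -> is_action act -> act_closed act N ->
  N `<=` act_span act [set x | x \in s] ->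
  exists2 u : seq V, [set x | x \in u] `<=` N &
    N `<=` act_span act [set x | x \in u].
Proof.
move=> noethR hact; elim: s N => [|g s IH] N hN Ns.
  by exists [::] => // x /Ns.
have hs := act_span_closed (act := act) [set x | x \in s].
pose lift r z := N z /\
  exists2 y, act_span act [set y | y \in s] y & z = act r g + y.
have hI : is_ideal [set r | exists z, lift r z].
  split; first split.
  - exists 0; split; first by case: hN => -[].
    by exists 0; rewrite ?(act0r hact) ?addr0; case: hs => -[].
  - move=> r r' [z [Nz [y sy zE]]] [z' [Nz' [y' sy' z'E]]].
    exists (z - z'); split; first by case: hN => -[_ +] _; apply.
    exists (y - y'); first by case: hs => -[_ +] _; apply.
    by rewrite (actBl hact) zE z'E addrACA -opprD.
  - move=> t r [z [Nz [y sy zE]]]; exists (act t z); split.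
      by case: hN => _; apply.
    exists (act t y); first by case: hs => _; apply.
    have -> : y = z - act r g by rewrite zE addrC addKr.
    by rewrite (actM hact) (actB hact) addrC subrK.
have [rs rsE] := noethR _ hI.
have [u uN hu] := IH (N `&` act_span act [set x | x \in s])
  (act_closedI hN hs) (@subIsetr _ _ _).
pose L r := xget 0 (lift r).
have LP r : r \in rs -> lift r (L r).
  move=> rrs; have : [set r | exists z, lift r z] r.
    by rewrite rsE; apply: act_span_incl.
  by move=> [z hz]; apply: (xgetPex 0 (ex_intro _ z hz)).
exists (map L rs ++ u).
  move=> x /=; rewrite mem_cat => /orP[/mapP[r /LP[Nr _] ->] //|].
  by move=> /uN[].
move=> x Nx; have [r [y sy xE]] := act_span_cons hact (Ns _ Nx).
set U := act_span _ _; have hU : act_closed act U by apply: act_span_closed.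
(* The coefficients attained by elements of both N and U. They are stable under the action and
   contain [rs], hence exhaust the ideal; subtracting such a z from x removes its g-component. *)
pose J := [set r | exists2 z, N z /\ U z &
  exists2 y, act_span act [set y | y \in s] y & z = act r g + y].
have : J r.
  have : [set r | exists z, lift r z] r by exists x; split=> //; exists y.
  rewrite rsE; move: (r); apply: act_span_min => {r y sy xE}.
    split; first split.
    - exists 0; first by split; [case: hN => -[]|case: hU => -[]].
      by exists 0; rewrite ?(act0r hact) ?addr0; case: hs => -[].
    - move=> r r' [z [Nz Uz] [y sy zE]] [z' [Nz' Uz'] [y' sy' z'E]].
      exists (z - z').
        by split; [case: hN => -[_ +] _; apply|case: hU => -[_ +] _; apply].
      exists (y - y'); first by case: hs => -[_ +] _; apply.
      by rewrite (actBl hact) zE z'E addrACA -opprD.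
    - move=> t r [z [Nz Uz] [y sy zE]]; exists (act t z).
        by split; [case: hN => _; apply|case: hU => _; apply].
      exists (act t y); first by case: hs => _; apply.
      have -> : y = z - act r g by rewrite zE addrC addKr.
      by rewrite (actM hact) (actB hact) addrC subrK.
  move=> r /= rrs; have [Nr hr] := LP r rrs; exists (L r) => //; split=> //.
  by apply: act_span_incl => /=; rewrite mem_cat map_f.
move=> [z [Nz Uz] [y' sy' zE]].
have -> : x = z + (x - z) by rewrite addrC subrK.
apply: (@subgroupD _ U) => //; first by case: hU.
have uU : act_span act [set v | v \in u] `<=` U.
  by apply: act_spanS => v /= vu; rewrite mem_cat vu orbT.
apply: uU; apply: hu; split; first by case: hN => -[_ +] _; apply.
have -> : x - z = y - y' by rewrite xE zE opprD addrACA subrr add0r.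
by case: hs => -[_ +] _; apply.
Qed.

Lemma noetherian_surj (R S : comPzRingType) (f : {rmorphism R -> S}) :
  range f = [set: S] -> noetherian R -> noetherian S.
Proof.
move=> fsurj noethR I hI.
have hfI : is_ideal (f @^-1` I).
  split; first by apply: preim_subgroup; [exact: rmorphB|case: hI].
  by move=> r x; rewrite /preimage /= rmorphM; case: hI => _; apply.
have [s sE] := noethR _ hfI; exists (map f s).
apply/seteqP; split=> y.
  have : range f y by rewrite fsurj.
  move=> [x _ <-] => Ifx; have : (f @^-1` I) x by [].
  rewrite sE; move: (x); apply: act_span_min.
    have hS := act_span_closed (act := *%R) [set x | x \in map f s].
    split; first by apply: preim_subgroup; [exact: rmorphB|case: hS].
    by move=> r z; rewrite /preimage /= rmorphM; case: hS => _; apply.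
  by move=> z /= zs; apply: act_span_incl => /=; apply: map_f.
move: y; apply: act_span_min => // _ /= /mapP[x xs ->].
by rewrite -[I _]/((f @^-1` I) x) sE; apply: act_span_incl.
Qed.

Lemma noetherian_field (k : fieldType) : noetherian k.
Proof.
move=> I hI; have [[x Ix x0]|h] := pselect (exists2 x, I x & x != 0).
  exists [:: 1]; apply/seteqP; split=> y.
    move=> _ B [[_ hB] B1]; rewrite -[y]mulr1; apply: hB; apply: B1.
    by rewrite /= inE.
  move=> _; rewrite -[y](divfK x0).
  by case: hI => _; apply.
exists [::]; apply/seteqP; split=> y.
  case: (eqVneq y 0) => [-> _|y0 Iy]; last by exfalso; apply: h; exists y.
  by case: (act_span_closed (act := *%R) [set x : k | x \in [::]]) => -[].
by move: y; apply: act_span_min.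
Qed.

(* Hilbert's basis theorem: the leading coefficients of elements of I generate
   a finitely generated ideal, which reduces I to its elements of bounded
   degree, and those form a submodule of a finitely generated module. *)
Lemma noetherian_poly (A : comNzRingType) : noetherian A -> noetherian {poly A}.
Proof.
move=> noethA I hI; have [[I0 IB] IM] := hI.
(* The coefficient c may vanish: asking only for degree at most d avoids a case distinction when
   leading terms cancel. *)
pose lift c f := I f /\ exists2 d, (size f <= d.+1)%N & f`_d = c.
have hL : is_ideal [set c | exists f, lift c f].
  split; first split.
  - by exists 0; split=> //; exists 0%N; rewrite ?size_poly0 ?coef0.
  - move=> b c [f [If [d sf <-]]] [g [Ig [e sg <-]]].
    exists ('X^e * f - 'X^d * g); split; first by apply: IB; apply: IM.
    exists (d + e)%N; last first.
      by rewrite coefB !coefXnM ltnNge leq_addl ltnNge leq_addr /= addnK addKn.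
    apply: leq_trans (size_polyD _ _) _; rewrite size_polyN geq_max.
    rewrite !(leq_trans (size_polyMleq _ _)) // size_polyXn addSn /=.
      by rewrite -addnS leq_add2l.
    by rewrite addnC -addSn leq_add2r.
  - move=> r _ [f [If [d sf <-]]]; exists (r%:P * f); split; first exact: IM.
    by exists d; rewrite ?coefCM // mul_polyC (leq_trans (size_scale_leq _ _)).
have [rs rsE] := noethA _ hL.
pose F r := xget 0 (lift r).
have FP r : r \in rs -> lift r (F r).
  move=> rrs; have : [set c | exists f, lift c f] r.
    by rewrite rsE; apply: act_span_incl.
  by move=> [f hf]; apply: (xgetPex 0 (ex_intro _ f hf)).
pose D := \max_(r <- rs) size (F r).
have hact := action_scale {poly A}.
have hID : act_closed *:%R (I `&` [set f : {poly A} | (size f <= D)%N]).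
  split; first split.
  - by split=> //=; rewrite size_poly0.
  - move=> f g [If sf] [Ig sg]; split; first exact: IB.
    by rewrite /= (leq_trans (size_polyD _ _)) // size_polyN geq_max sf sg.
  - move=> r f [If sf]; split; first by rewrite -mul_polyC; apply: IM.
    by rewrite /= (leq_trans (size_scale_leq _ _)).
have [|u uI hu] := @noetherian_submodule _ _ _
    [seq 'X^i | i <- iota 0 D] _ noethA hact hID.
  move=> f [_ /= sf].
  have [hs hZ] := act_span_closed (act := *:%R)
    [set x : {poly A} | x \in [seq 'X^i | i <- iota 0 D]].
  rewrite -[f]coefK (poly_def).
  apply: (@subgroup_sum _ _ _ _ _ (act_span _ _)) => // i _; apply: hZ.
  apply: act_span_incl => /=; apply: map_f.
  by rewrite mem_iota /= add0n (leq_trans (ltn_ord i)).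
exists (map F rs ++ u).
set U := act_span _ _; have [[U0 UB] UM] : is_ideal U by apply: act_span_closed.
apply/seteqP; split=> [f|].
  have [N] := ubnP (size f); elim: N f => // N IH f sfN If.
  have [sfD|Dsf] := leqP (size f) D.
    have : act_span *:%R [set x | x \in u] f by apply: hu.
    move: (f); apply: act_span_min; last first.
      by move=> x xu; apply: act_span_incl; rewrite /= mem_cat; apply/orP;
        right.
    by split=> // r x; rewrite -mul_polyC; apply: UM.
  have f0 : (0 < size f)%N by apply: leq_ltn_trans Dsf.
  pose d := (size f).-1.
  have sfd : size f = d.+1 by rewrite prednK.
  pose J := [set c | exists h, [/\ I h, U h, (size h <= d.+1)%N & h`_d = c]].
  have : J f`_d.
    have : [set c | exists f, lift c f] f`_d.
      by exists f; split=> //; exists d; rewrite ?sfd.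
    rewrite rsE; move: (f`_d); apply: act_span_min.
      split; first split.
      - by exists 0; rewrite size_poly0 coef0.
      - move=> b c [g [Ig Ug sg <-]] [h [Ih Uh sh <-]]; exists (g - h); split.
        + exact: IB.
        + exact: UB.
        + by rewrite (leq_trans (size_polyD _ _)) // size_polyN geq_max sg.
        + by rewrite coefB.
      - move=> r _ [g [Ig Ug sg <-]]; exists (r%:P * g); split.
        + exact: IM.
        + exact: UM.
        + by rewrite mul_polyC (leq_trans (size_scale_leq _ _)).
        + by rewrite coefCM.
    move=> r /= rrs; have [IFr [e sFr Fre]] := FP _ rrs.
    have sFD : (size (F r) <= D)%N by rewrite /D (big_rem r rrs) /= leq_maxl.
    (* If e exceeds d, then [F r] has size at most D <= d, so r = 0 and the zero polynomial
       serves. *)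
    have [ed|de] := leqP e d; last first.
      exists 0; split=> //; first by rewrite size_poly0.
      rewrite coef0 -Fre nth_default // (leq_trans sFD) // ltnW //.
      by rewrite (leq_trans Dsf) // sfd.
    exists ('X^(d - e) * F r); split.
    - exact: IM.
    - by apply: UM; apply: act_span_incl; rewrite /= mem_cat map_f.
    - rewrite (leq_trans (size_polyMleq _ _)) // size_polyXn addSn /=.
      by rewrite (leq_trans (leq_add (leqnn _) sFr)) // addnS subnK.
    - by rewrite coefXnM ltnNge leq_subr /= subKn.
  move=> [h [Ih Uh sh hd]].
  have -> : f = h - (h - f) by rewrite opprD opprK addrA subrr add0r.
  apply: UB => //; apply: IH; last exact: IB.
  apply: leq_trans (_ : _ < d.+1)%N _; last by rewrite -sfd.
  rewrite ltnS.
  apply/leq_sizeP => j; rewrite leq_eqVlt => /orP[/eqP <-|dj].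
    by rewrite coefB hd subrr.
  by rewrite coefB !nth_default ?subrr ?(leq_trans _ dj) ?sfd.
apply: act_span_min => // x /=; rewrite mem_cat => /orP[/mapP[r /FP[IF _]
  ->]//|].
by move=> /uI[].
Qed.

Lemma noetherian_mpoly (k : fieldType) (n : nat) : noetherian (mpoly n k).
Proof.
elim: n => [|n IH].
  apply: (noetherian_surj (f := @mpolyC 0 k)) (@noetherian_field k).
  apply/seteqP; split=> // f _; exists (mcoeff (@mnm0 0) f) => //.
  apply/mpolyP => m; rewrite mcoeffC.
  have -> : m = @mnm0 0 by apply/mnmP => -[].
  by rewrite eqxx mulr1.
pose f : {rmorphism {poly (mpoly n k)} -> mpoly n.+1 k} :=
  @horner_eval (mpoly n.+1 k) (mpolyX k (mnm1 ord_max))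
  \o map_poly (@mwiden n k).
apply: (noetherian_surj (f := f)) (noetherian_poly IH).
apply/seteqP; split=> // q _.
pose S := range f; have SD : forall x y, S x -> S y -> S (x + y).
  by move=> _ _ [x _ <-] [y _ <-]; exists (x + y) => //; rewrite rmorphD.
have SM : forall x y, S x -> S y -> S (x * y).
  by move=> _ _ [x _ <-] [y _ <-]; exists (x * y) => //; rewrite rmorphM.
have S0 : S 0 by exists 0; rewrite ?rmorph0.
have S1 : S 1 by exists 1; rewrite ?rmorph1.
have SC c : S (mpolyC _ c).
  exists (polyC (mpolyC _ c)) => //.
  by rewrite /f /= map_polyC /= /horner_eval hornerC mwidenC.
have SX i : S (mpolyX k (mnm1 i)).
  case: (unliftP ord_max i) => [j ->|->].
    exists (polyC (mpolyX k (mnm1 j))) => //.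
    rewrite /f /= map_polyC /= /horner_eval hornerC mwidenX mnmwiden1.
    by congr (mpolyX k (mnm1 _)); apply: val_inj;
      rewrite /= /bump leqNgt ltn_ord.
  by exists 'X => //; rewrite /f /= map_polyX /horner_eval hornerX.
rewrite [q]mpolyE; apply: (big_ind S) => // m _.
rewrite -mul_mpolyC; apply: (SM) => //; rewrite mpolyXE_id.
apply: (big_ind S) => // i _; elim: (m i) => [|e IHe]; first by rewrite expr0.
by rewrite exprS; apply: SM.
Qed.

(** Otherwise choice produces a strictly ascending chain in F; its union is finitely generated and
    therefore already contained in one member. *)
Lemma noetherian_maximal (R : comPzRingType) (F : set (set R)) (I0 : set R) :
  noetherian R -> (forall I, F I -> is_ideal I) -> F I0 ->
  exists2 I, F I & forall J, F J -> I `<=` J -> J `<=` I.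
Proof.
move=> noethR Fideal FI0; apply: contrapT => hmax.
have next I : exists J, F I -> [/\ F J, I `<=` J & ~ J `<=` I].
  have [FI|nFI] := pselect (F I); last by exists I.
  apply: contrapT => hI; apply: hmax; exists I => // J FJ IJ.
  by apply: contrapT => JI; apply: hI; exists J.
have [f fP] := choice next.
pose S i := iter i f I0.
have FS i : F (S i) by elim: i => //= i /fP[].
have Sinc i j : (i <= j)%N -> S i `<=` S j.
  move/subnK <-; elim: (j - i)%N => // d IH; apply: subset_trans IH _.
  by have [] := fP _ (FS (d + i)%N).
have hU : is_ideal (\bigcup_(i in [set: nat]) S i).
  split; first split.
  - by exists 0%N => //; have [[]] := Fideal _ (FS 0%N).
  - move=> x y [i _ xi] [j _ yj]; exists (maxn i j) => //.
    have [[_ +] _] := Fideal _ (FS (maxn i j)).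
    by apply; [apply: Sinc xi|apply: Sinc yj]; rewrite ?leq_maxl ?leq_maxr.
  - by move=> r x [i _ xi]; exists i => //; have [_] := Fideal _ (FS i); apply.
have [s sE] := noethR _ hU.
have [i hi] : exists i, [set x | x \in s] `<=` S i.
  have : [set x | x \in s] `<=` \bigcup_(i in [set: nat]) S i.
    by rewrite sE; apply: act_span_incl.
  elim: (s) => [|x t IH] hs; first by exists 0%N.
  have [|i hi] := IH; first by move=> y /= yt; apply: hs;
    rewrite /= inE yt orbT.
  have [|j _ xj] := hs x; first by rewrite /= mem_head.
  exists (maxn i j) => y; rewrite /= inE => /orP[/eqP ->|yt].
    by apply: Sinc xj; rewrite leq_maxr.
  by apply: (Sinc _ _ (leq_maxl i j)); apply: hi.
have [_ _ []] := fP _ (FS i).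
have : \bigcup_(i in [set: nat]) S i `<=` S i.
  by rewrite sE; apply: act_span_min => //; apply: Fideal.
by apply: subset_trans => x xS; exists i.+1.
Qed.

(** * Prime ideals and irreducible sets of primes *)

Section Primes.
Context {R : comPzRingType}.
Implicit Types P Q eta : set R.

Lemma prime_notM P x y : is_prime P -> ~ P x -> ~ P y -> ~ P (x * y).
Proof. by move=> [_ _ hP] Px Py /hP[]. Qed.

Lemma prime_notX P x n : is_prime P -> ~ P x -> ~ P (x ^+ n).
Proof.
move=> hP Px; elim: n => [|n IH]; first by case: hP.
by rewrite exprS; apply: prime_notM.
Qed.

Lemma ideal_Mr P x r : is_ideal P -> P x -> P (x * r).
Proof. by rewrite mulrC => -[_]; apply. Qed.

Lemma generic_pointE Y eta :
  generic_point Y eta <-> is_prime eta /\ Y = [set P | is_prime P /\ eta `<=`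
    P].
Proof.
rewrite /generic_point; have E : is_prime eta ->
    smallest (@zariski_closed R) [set eta] = [set P | is_prime P /\ eta `<=` P].
  move=> heta; apply/seteqP; split=> [P|P [hP etaP] _ [[E ->] hE]].
    move=> /(_ [set P | is_prime P /\ eta `<=` P]); apply.
    by split=> [|_ ->]; [exists eta|split].
  split=> //; have [_ Eeta] := hE _ erefl.
  exact: subset_trans etaP.
by split=> -[heta ->]; split=> //; rewrite E.
Qed.

Lemma irreducible_closure eta :
  is_prime eta -> irreducible [set P | is_prime P /\ eta `<=` P].
Proof.
move=> heta; split; first by exists eta; split.
move=> _ _ [A ->] [B ->] hAB.
by have [[_ h]|[_ h]] := hAB eta (conj heta (@subset_refl _ _)); [left|right];
  move=> P [hP etaP]; split=> //; apply: subset_trans etaP.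
Qed.

(** If x y lies in every member of Y, then V(x) and V(y) cover Y, and irreducibility puts Y inside
    one of them. *)
Lemma irreducible_bigcap (Y : set (set R)) :
  (forall P, Y P -> is_prime P) -> irreducible Y ->
  is_prime (\bigcap_(P in Y) P).
Proof.
move=> Yprime [[P0 YP0] hY]; split.
- split; first split.
  + by move=> P /Yprime[[[]]].
  + move=> x y hx hy P YP; have [[[_ hB] _] _ _] := Yprime _ YP.
    by apply: hB; [apply: hx|apply: hy].
  + move=> r x hx P YP; have [[_ hM] _ _] := Yprime _ YP.
    by apply: hM; apply: hx.
- by move=> /(_ _ YP0); case: (Yprime _ YP0).
- move=> x y hxy.
  have [||P YP|h|h] := hY [set P | is_prime P /\ [set x] `<=` P]
                          [set P | is_prime P /\ [set y] `<=` P].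
  + by exists [set x].
  + by exists [set y].
  + have hP := Yprime _ YP; have [_ _ /(_ _ _ (hxy _ YP))] := hP.
    by case=> ?; [left|right]; split=> // _ ->.
  + by left=> P /h[_]; apply.
  + by right=> P /h[_]; apply.
Qed.

End Primes.

(** * Localization, support and its generic points *)

Section Support.
Context {R : comPzRingType} {C : pzRingType} {iota : {rmorphism R -> C}}.
Context {M : lmodType C}.
Implicit Types (N : set M) (P eta : set R).

Definition ract (r : R) (x : M) : M := iota r *: x.

Lemma action_ract : is_action ract.
Proof.
by split=> *; rewrite /ract ?scalerBr // ?(rmorphB, rmorphM, rmorph1)
  ?scalerBl ?scalerA ?scale1r.
Qed.

(** For a submodule N and a prime P, the preimage of N_P under M -> M_P; comparing localizations
    through it avoids fractions. *)
Definition saturation P N : set M := [set x | exists2 w, ~ P w & N (ract w x)].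

Lemma sub_saturation P N : is_prime P -> N `<=` saturation P N.
Proof.
by move=> [_ P1 _] x Nx; exists 1; rewrite // (act1 action_ract).
Qed.

Lemma saturationS P N N' : N `<=` N' -> saturation P N `<=` saturation P N'.
Proof. by move=> NN' x [w Pw Nx]; exists w => //; apply: NN'. Qed.

Lemma localizeE P N : is_prime P -> act_closed ract N ->
  localize iota P N = [set u | ~ P u.2 /\ saturation P N u.1].
Proof.
move=> hP [hN aN]; apply/seteqP; split=> -[x s] [/= Ps].
  move=> [y [t [Ny Pt [w [Pw /= E]]]]]; split=> //.
  exists (w * t); first exact: prime_notM.
  by rewrite /ract E; apply: aN.
move=> [w Pw Nx]; split=> //; exists (ract w x), (s * w).
split=> //; first exact: prime_notM.
exists 1; split; first by case: hP.
by rewrite /= !mul1r rmorphM scalerA.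
Qed.

Lemma localize_eqP P N N' : is_prime P ->
    act_closed ract N -> act_closed ract N' ->
  localize iota P N = localize iota P N' <->
  saturation P N = saturation P N'.
Proof.
move=> hP hN hN'; rewrite !localizeE //; split=> [E|-> //].
have P1 : ~ P 1 by case: hP.
apply/seteqP; split=> x hx.
  have : [set u | ~ P u.2 /\ saturation P N u.1] (x, 1) by [].
  by rewrite E => -[].
have : [set u | ~ P u.2 /\ saturation P N' u.1] (x, 1) by [].
by rewrite -E => -[].
Qed.

Lemma module_supportE N : act_closed ract N ->
  module_support iota N = [set P | is_prime P /\
    exists2 x, N x & forall w, ~ P w -> ract w x <> 0].
Proof.
move=> hN; apply/seteqP; split=> P [hP].
  move=> [[x s]]; rewrite localizeE // => -[/= Ps [w Pw Nwx]] hx; split=> //.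
  exists (ract w x) => // v Pv E; apply: hx; exists (v * w).
  split; first exact: prime_notM.
  by rewrite /= mulr1 scaler0 -[LHS]/(ract (v * w) x) (actM action_ract).
move=> [x Nx hx]; split=> //; have P1 : ~ P 1 by case: hP.
exists (x, 1).
  by rewrite localizeE //; split=> //; apply: sub_saturation.
move=> [w [Pw]]; rewrite /= !mulr1 scaler0; exact: hx.
Qed.

Lemma module_supportS N N' : act_closed ract N -> act_closed ract N' ->
  N `<=` N' -> module_support iota N `<=` module_support iota N'.
Proof.
move=> hN hN' NN' P; rewrite !module_supportE // => -[hP [x Nx hx]].
by split=> //; exists x => //; apply: NN'.
Qed.

Definition finitely_generated (A : set M) :=
  exists2 s : seq M, [set x | x \in s] `<=` A &
    A `<=` act_span ract [set x | x \in s].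

(** The elements w belonging to finitely many generators multiply to one element outside P. The
    factor u is 1 for supports and a colon element in [minimal_support_not_ideal]. *)
Lemma common_annihilator N P u : finitely_generated N -> is_prime P ->
    (forall x, N x -> exists2 w, ~ P w & ract (w * u) x = 0) ->
  exists2 w, ~ P w & forall x, N x -> ract (w * u) x = 0.
Proof.
move=> [s sN Ns] hP kill.
have [w Pw hw] : exists2 w, ~ P w & forall x, x \in s -> ract (w * u) x = 0.
  elim: s sN {Ns} => [|x s IH] sN; first by exists 1 => //; case: hP.
  have [|w Pw hw] := IH.
    by move=> y ys; apply: sN; rewrite /= inE; apply/orP; right.
  have [|v Pv hv] := kill x; first by apply: sN; rewrite /= mem_head.
  exists (w * v); first exact: prime_notM.
  move=> y; rewrite inE => /orP[/eqP ->|ys].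
    by rewrite -mulrA (actM action_ract) hv (actr0 action_ract).
  by rewrite mulrAC mulrC (actM action_ract) hw // (actr0 action_ract).
exists w => // x /Ns.
have := act_closed_preim action_ract (w * u) (act_closed0 action_ract).
by move=> /act_span_min; apply=> y ys; apply: hw.
Qed.

(** If N_P were zero, a single element outside P would kill the finitely generated N. *)
Lemma support_annihilator N P :
    act_closed ract N -> finitely_generated N -> is_prime P ->
    (forall r, (forall x, N x -> ract r x = 0) -> P r) ->
  module_support iota N P.
Proof.
move=> hN fgN hP hann; rewrite module_supportE //; split=> //.
apply: contrapT => hx.
have [|w Pw hw] := @common_annihilator N P 1 fgN hP; last first.
  by apply: Pw; apply: hann => x /hw; rewrite mulr1.
move=> x Nx; apply: contrapT => hw; apply: hx; exists x => // w Pw wx.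
by apply: hw; exists w; rewrite ?mulr1.
Qed.

Definition minimal_support N eta :=
  module_support iota N eta /\
  forall P, module_support iota N P -> P `<=` eta -> eta `<=` P.

(** The closure of a support prime P below eta is irreducible, lies in the support and contains Y;
    maximality of Y makes it equal to Y. *)
Lemma component_minimal N Y eta :
  irreducible_component (module_support iota N) Y -> generic_point Y eta ->
  act_closed ract N -> minimal_support N eta.
Proof.
move=> [YN Yirr Ymax] /generic_pointE[heta YE] hN.
have Yeta : Y eta by rewrite YE; split.
split=> [|P PN Peta]; first exact: YN.
have hP : is_prime P by case: PN.
pose Z := [set P' : set R | is_prime P' /\ P `<=` P'].
have YZ : Y `<=` Z.
  by rewrite YE => P' [hP' etaP']; split=> //; apply: subset_trans etaP'.
have : Z = Y.
  apply: Ymax => //; first exact: irreducible_closure.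
  move=> P' [hP' PP']; move: PN; rewrite !module_supportE // => -[_ [x Nx hx]].
  by split=> //; exists x => // w wP'; apply: hx => /PP'.
move=> ZY; have : Y P by rewrite -ZY; split.
by rewrite YE => -[].
Qed.

(** An irreducible Y in the support that contains the closure of eta has a prime intersection. This
    contains the annihilator of N, so it lies in the support, and it is below eta; by minimality
    every member of Y then contains eta. *)
Lemma minimal_component N eta :
    act_closed ract N -> finitely_generated N -> minimal_support N eta ->
  exists2 Y, irreducible_component (module_support iota N) Y &
    generic_point Y eta.
Proof.
move=> hN fgN [etaN etamin]; have heta : is_prime eta by case: etaN.
exists [set P | is_prime P /\ eta `<=` P]; last exact/generic_pointE.
split; last 1 first.
- move=> Y Yirr YN etaY; apply/seteqP; split=> // P YP.
  have hP : is_prime P by case: (YN _ YP).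
  have Yprime P' : Y P' -> is_prime P' by case/YN.
  have hI := irreducible_bigcap Yprime Yirr.
  split=> //; apply: (@subset_trans _ (\bigcap_(P in Y) P)); last first.
    by move=> x; apply.
  apply: etamin; last by move=> x; apply; apply: etaY; split.
  apply: support_annihilator => // r hr P' YP'.
  apply: contrapT => P'r.
  have := YN _ YP'; rewrite module_supportE // => -[_ [x Nx /(_ _ P'r)]].
  by apply; apply: hr.
- move=> P [hP etaP]; move: etaN; rewrite !module_supportE // => -[_ [x Nx hx]].
  by split=> //; exists x => // w wP; apply: hx => /etaP.
- exact: irreducible_closure.
Qed.

(* The ideal Q below is the annihilator of N localized at eta, contracted to
   R; a colon ideal (Q : u) that is maximal among the proper ones is prime. *)
Lemma minimal_support_colon N eta (Q := [set r | exists2 s, ~ eta s &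
      forall x, N x -> ract (s * r) x = 0]) :
    noetherian R -> act_closed ract N -> finitely_generated N ->
    minimal_support N eta ->
  exists2 u, ~ Q u & forall r, eta r -> Q (r * u).
Proof.
move=> noethR hN fgN [etaN etamin]; have heta : is_prime eta by case: etaN.
have [[[eta0 etaB] etaM] eta1 etaP] := heta.
have hQ : is_ideal Q.
  split; first split.
  - by exists 1 => // x Nx; rewrite mulr0 (act0r action_ract).
  - move=> x y [s Ps hs] [t Pt ht]; exists (s * t); first exact: prime_notM.
    move=> z Nz; rewrite mulrBr -!mulrA mulrCA (actBl action_ract).
    by rewrite !(actM action_ract _ (_ * _)) hs // ht // !(actr0 action_ract)
      subrr.
  - move=> r x [s Ps hs]; exists s => // z Nz.
    by rewrite mulrCA (actM action_ract) hs // (actr0 action_ract).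
have Q1 : ~ Q 1.
  move=> [s Ps hs]; move: etaN; rewrite module_supportE // => -[_ [x Nx /(_ _
    Ps)]].
  by apply; rewrite -[s]mulr1; apply: hs.
pose F := [set I | exists2 u, ~ Q u & I = [set r | Q (r * u)]].
have hF I : F I -> is_ideal I.
  move=> [u Qu ->]; have [[Q0 QB] QM] := hQ; split; first split.
  - by rewrite /= mul0r.
  - by move=> x y; rewrite /= mulrBl; apply: QB.
  - by move=> r x; rewrite /= -mulrA; apply: QM.
have [|P [u Qu PE] Pmax] := @noetherian_maximal _ F [set r | Q (r * 1)] noethR
  hF.
  by exists 1.
have hP : is_prime P.
  split; first by apply: hF; exists u.
    by rewrite PE /= mul1r.
  move=> x y Pxy; apply: contrapT => /not_orP[Px Py].
  apply: Py; apply: (Pmax [set r | Q (r * (x * u))]).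
  - by exists (x * u) => //; move: Px; rewrite PE.
  - by move=> r; rewrite PE /= mulrCA; case: hQ => _; apply.
  - by move: Pxy; rewrite PE /= mulrCA mulrA.
exists u => // r etar; have -> : Q (r * u) = P r by rewrite PE.
(* P is in the support because it contains the annihilator of N, and it lies below eta because an
   element of P outside eta would put u into Q. *)
apply: (etamin P) etar.
  apply: support_annihilator => // s hs; rewrite PE; exists 1 => // x Nx.
  by rewrite mul1r mulrC (actM action_ract) hs // (actr0 action_ract).
move=> s; rewrite PE => -[t Pt ht]; apply: contrapT => Ps.
apply: Qu; exists (t * s); first exact: prime_notM.
by move=> x /ht; rewrite mulrA.
Qed.

End Support.
Arguments ract {R C} iota {M} r x.
Arguments action_ract {R C} iota M.
Arguments saturation {R C} iota {M} P N.
Arguments finitely_generated {R C} iota {M} A.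
Arguments minimal_support {R C} iota {M} N eta.

(** * Powers of an ideal *)

Section IdealPowers.
Context {R : comPzRingType} {a : set R}.

Lemma ideal_pow_ideal m : is_ideal (ideal_pow a m).
Proof. exact: act_span_closed. Qed.

Lemma ideal_pow_prod m (f : 'I_m -> R) :
  (forall i, a (f i)) -> ideal_pow a m (\prod_(i < m) f i).
Proof. by move=> hf; apply: act_span_incl; exists f. Qed.

Lemma ideal_pow_min m (I : set R) : is_ideal I ->
  (forall f : 'I_m -> R, (forall i, a (f i)) -> I (\prod_(i < m) f i)) ->
  ideal_pow a m `<=` I.
Proof. by move=> hI h; apply: act_span_min => // _ [f hf <-]; apply: h. Qed.

Lemma ideal_pow0 r : ideal_pow a 0 r.
Proof.
have [_ hM] := ideal_pow_ideal 0; rewrite -[r]mulr1; apply: hM.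
have /= := @ideal_pow_prod 0 (fun=> 1); rewrite big_ord0; apply.
by case.
Qed.

Lemma colon_ideal (I : set R) s : is_ideal I -> is_ideal [set r | I (r * s)].
Proof.
move=> [[I0 IB] IM]; split; first split=> [|x y]; rewrite /= ?mul0r ?mulrBl //.
  exact: IB.
by move=> r x; rewrite /= -mulrA; apply: IM.
Qed.

Lemma ideal_powD m n r s :
  ideal_pow a m r -> ideal_pow a n s -> ideal_pow a (m + n) (r * s).
Proof.
move=> + hs; move: r; apply: ideal_pow_min.
  exact: (colon_ideal s (ideal_pow_ideal (m + n))).
move=> f hf; rewrite /= mulrC; move: s hs; apply: ideal_pow_min.
  exact: (colon_ideal _ (ideal_pow_ideal (m + n))).
move=> g hg; rewrite /= mulrC.
pose h i := match split i with inl j => f j | inr j => g j end.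
have -> : \prod_(i < m) f i * \prod_(i < n) g i = \prod_(i < m + n) h i.
  rewrite big_split_ord /=; congr (_ * _); apply: eq_bigr => i _; rewrite /h.
    by rewrite -[lshift _ _]/(unsplit (inl i)) unsplitK.
  by rewrite -[rshift _ _]/(unsplit (inr i)) unsplitK.
by apply: ideal_pow_prod => i; rewrite /h; case: split.
Qed.

Lemma ideal_powXn m q r : ideal_pow a m r -> ideal_pow a (m * q) (r ^+ q).
Proof.
move=> hr; elim: q => [|q IH]; first by rewrite muln0; apply: ideal_pow0.
by rewrite exprS mulnS; apply: ideal_powD.
Qed.

Lemma ideal_powX r q : a r -> ideal_pow a q (r ^+ q).
Proof.
move=> ar; have := @ideal_pow_prod q (fun=> r).
by rewrite prodr_const card_ord; apply.
Qed.

Lemma ideal_pow_anti m n : (m <= n)%N -> ideal_pow a n `<=` ideal_pow a m.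
Proof.
move/subnKC <-; apply: ideal_pow_min; first exact: ideal_pow_ideal.
move=> f hf; rewrite big_split_ord /=; apply: (@ideal_Mr _ (ideal_pow a m)).
  exact: ideal_pow_ideal.
by apply: ideal_pow_prod.
Qed.

Lemma ideal_pow_sub m : is_ideal a -> (0 < m)%N -> ideal_pow a m `<=` a.
Proof.
case: m => // m ha _; apply: ideal_pow_min => // f hf.
by rewrite big_ord_recl; apply: ideal_Mr.
Qed.

End IdealPowers.

(** * The exponents ceil(t (p^e - 1)) *)

Section TwistExponent.
Context {RR : realType} {p : nat}.
Implicit Types t : RR.

Lemma absz_ceil_le (x : RR) n : 0 <= x -> (`|Num.ceil x| <= n)%N = (x <= n%:R).
Proof.
move=> x0; have c0 : 0 <= Num.ceil x by rewrite ceil_ge0 (lt_le_trans _ x0)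
  ?ltrN10.
by rewrite -lez_nat gez0_abs // ceil_le_int.
Qed.

Lemma absz_ceil_ge (x : RR) : 0 <= x -> x <= `|Num.ceil x|%:R.
Proof. by move=> x0; rewrite -absz_ceil_le. Qed.

Definition twist_exp t e := `|Num.ceil (t * (p ^ e - 1)%:R)|%N.

Lemma twist_exp0 t : twist_exp t 0 = 0%N.
Proof. by rewrite /twist_exp expn0 subnn mulr0 ceil0. Qed.

(** From p^(d+e) - 1 = (p^d - 1) p^e + (p^e - 1). This is what closes C^(a^t) under products, since
    r passes a map of degree e as r^(p^e). *)
Lemma twist_expD t d e : 0 <= t -> (0 < p)%N ->
  (twist_exp t (d + e) <= twist_exp t d * p ^ e + twist_exp t e)%N.
Proof.
move=> t0 p0; rewrite absz_ceil_le ?mulr_ge0 // natrD natrM.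
have -> : (p ^ (d + e) - 1 = (p ^ d - 1) * p ^ e + (p ^ e - 1))%N.
  rewrite expnD mulnBl mul1n addnBA ?expn_gt0 ?p0 // subnK //.
  by rewrite leq_pmull // expn_gt0 p0.
rewrite natrD mulrDr natrM mulrA; apply: lerD; last first.
  by apply: absz_ceil_ge; rewrite mulr_ge0.
by rewrite ler_wpM2r //; apply: absz_ceil_ge; rewrite mulr_ge0.
Qed.

Lemma twist_exp_gt0 t e : 0 < t -> (1 < p)%N -> (1 <= e)%N ->
  (0 < twist_exp t e)%N.
Proof.
move=> t0 p1 e1; rewrite lt0n -leqn0 absz_ceil_le;
  last by rewrite mulr_ge0 // ltW.
by rewrite -ltNge mulr_gt0 // ltr0n subn_gt0 -[1%N](exp1n e) ltn_exp2r.
Qed.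

Lemma twist_exp_homo t t' e : 0 <= t -> t <= t' ->
  (twist_exp t e <= twist_exp t' e)%N.
Proof.
move=> t0 tt'; rewrite absz_ceil_le ?mulr_ge0 //.
apply: (@le_trans _ _ (t' * (p ^ e - 1)%:R)); first by rewrite ler_wpM2r.
by apply: absz_ceil_ge; rewrite mulr_ge0 // (le_trans t0).
Qed.

Lemma twist_exp_le t e B : 0 <= t -> t <= B%:R ->
  (twist_exp t e <= B * (p ^ e - 1))%N.
Proof. by move=> t0 tB; rewrite absz_ceil_le ?mulr_ge0 // natrM ler_wpM2r. Qed.

End TwistExponent.
Arguments twist_exp {RR} p t e.

(** * Cartier subalgebras, F-purity and the stable submodule *)

Record is_cartier_subalgebra (R : comPzRingType) (C : pzRingType)
    (iota : {rmorphism R -> C}) (G D : nat -> set C) : Prop :=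
  IsCartierSubalgebra {
    subalgebra_subgroup : forall e, is_subgroup (D e);
    subalgebra_mul : forall d e x y, D d x -> D e y -> D (d + e)%N (x * y);
    subalgebra_iota : forall r, D 0%N (iota r);
    subalgebra_sub : forall e, D e `<=` G e
  }.

Section Subalgebras.
Context {p : nat} {R : comPzRingType} {C : pzRingType}.
Context {iota : {rmorphism R -> C}} {G : nat -> set C}.
Hypothesis (p_gt0 : (0 < p)%N) (hC : is_cartier_algebra p iota G).
Context {M : lmodType C}.
Implicit Types (N : set M) (D : nat -> set C).

Lemma alg_plus_subgroup D : is_subgroup (alg_plus D).
Proof. exact: smallest_subgroup. Qed.

Lemma alg_plus_incl D e x : (1 <= e)%N -> D e x -> alg_plus D x.
Proof. by move=> e1 Dx; apply: sub_gen_smallest; exists e. Qed.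

Lemma alg_total_incl D e x : D e x -> alg_total D x.
Proof. by move=> Dx; apply: sub_gen_smallest; exists e. Qed.

Lemma alg_total_mulr_plus D x y : is_cartier_subalgebra iota G D ->
  alg_total D x -> alg_plus D y -> alg_plus D (x * y) /\ alg_plus D (y * x).
Proof.
move=> hD hx hy; suff : alg_plus D `<=`
    [set y | alg_plus D (x * y) /\ alg_plus D (y * x)] by apply.
have hP := alg_plus_subgroup D.
apply: smallest_sub => {y hy}.
  split=> [|y z [? ?] [? ?]]; first by rewrite /= mulr0 mul0r; case: hP.
  by rewrite /= mulrBl mulrBr; split; apply: (subgroupB hP).
move=> y [e /= e1 Dy]; suff : alg_total D `<=`
    [set x | alg_plus D (x * y) /\ alg_plus D (y * x)] by apply.
apply: smallest_sub => {x hx}.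
  split=> [|x z [? ?] [? ?]]; first by rewrite /= mulr0 mul0r; case: hP.
  by rewrite /= mulrBl mulrBr; split; apply: (subgroupB hP).
move=> x [d _ Dx]; split.
  apply: (@alg_plus_incl _ (d + e)); first by rewrite addn_gt0 e1 orbT.
  exact: (subalgebra_mul hD).
apply: (@alg_plus_incl _ (e + d)); first by rewrite addn_gt0 e1.
exact: (subalgebra_mul hD).
Qed.

Lemma is_submod_ract D N : is_cartier_subalgebra iota G D ->
  is_submod D N -> act_closed (@ract _ _ iota M) N.
Proof.
move=> hD [hN aN]; split=> // r x; apply: aN.
by apply: (@alg_total_incl _ 0); apply: (subalgebra_iota hD).
Qed.

Lemma ract_scale e r phi (x : M) : G e phi ->
  ract iota r (phi *: x) = phi *: ract iota (r ^+ (p ^ e)%N) x.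
Proof. by move=> Gphi; rewrite /ract !scalerA (cartier_linear hC _ Gphi). Qed.

Lemma preim_scale_subgroup N (x : M) :
  is_subgroup N -> is_subgroup [set c : C | N (c *: x)].
Proof.
by move=> hN; apply: (@preim_subgroup C M (fun c => c *: x)) => // *;
  rewrite scalerBl.
Qed.

Lemma preim_scaler_subgroup N (c : C) :
  is_subgroup N -> is_subgroup [set x : M | N (c *: x)].
Proof.
by move=> hN; apply: (@preim_subgroup M M (fun x => c *: x)) => // *;
  rewrite scalerBr.
Qed.

Lemma is_submodP D N : is_subgroup N ->
  (forall e c x, D e c -> N x -> N (c *: x)) -> is_submod D N.
Proof.
move=> hN h; split=> // c x hc Nx.
suff : alg_total D `<=` [set c | N (c *: x)] by apply.
apply: smallest_sub; first exact: preim_scale_subgroup.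
by move=> d [e _ Dd]; apply: h Dd Nx.
Qed.

(** This is D_+ N. An additive span suffices, because D_+ absorbs multiplication by D from the
    left. *)
Definition plus_span D N : set M :=
  smallest (@is_subgroup M)
    [set phi *: y | phi in alg_plus D & y in N].

Lemma plus_span_incl D N phi y :
  alg_plus D phi -> N y -> plus_span D N (phi *: y).
Proof. by move=> hphi Ny; apply: sub_gen_smallest; exists phi => //;
  exists y. Qed.

Lemma plus_span_min D N Q : is_subgroup Q ->
  (forall e phi y, (1 <= e)%N -> D e phi -> N y -> Q (phi *: y)) ->
  plus_span D N `<=` Q.
Proof.
move=> hQ h; apply: smallest_sub => // _ [phi hphi [y Ny <-]].
suff : alg_plus D `<=` [set c | Q (c *: y)] by apply.
apply: smallest_sub; first exact: preim_scale_subgroup.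
by move=> d [e e1 Dd]; apply: h Dd Ny.
Qed.

Lemma plus_span_submod D N : is_cartier_subalgebra iota G D ->
  is_submod D (plus_span D N).
Proof.
move=> hD; have hS := @smallest_subgroup M [set phi *: y | phi in alg_plus D &
  y in N].
split=> // c x hc; move: x; apply: smallest_sub;
  first exact: preim_scaler_subgroup.
move=> _ [phi hphi [y Ny <-]]; rewrite /= scalerA; apply: plus_span_incl => //.
by have [] := alg_total_mulr_plus hD hc hphi.
Qed.

Lemma plus_span_sub D N : is_submod D N -> plus_span D N `<=` N.
Proof.
move=> [hN aN]; apply: plus_span_min => // e phi y _ Dphi; apply: aN.
exact: alg_total_incl Dphi.
Qed.

Definition F_pure D N := is_submod D N /\ N `<=` plus_span D N.

Lemma plus_pow_submod D n : is_submod D (plus_pow M D n).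
Proof.
split; first split.
- by move=> B [[[]]].
- by move=> x y hx hy B hB; have [[[_ +] _] _] := hB; apply;
    [apply: hx|apply: hy].
- by move=> c x hc hx B hB; have [[_ +] _] := hB; apply; last exact: hx.
Qed.

Lemma plus_pow_min D n N : is_submod D N ->
  (forall (phi : 'I_n -> C) m, (forall i, alg_plus D (phi i)) ->
     N ((\prod_(i < n) phi i) *: m)) ->
  plus_pow M D n `<=` N.
Proof. by move=> hN h; apply: smallest_sub => // _ [phi [m [hphi ->]]];
  apply: h. Qed.

Lemma plus_pow0 D x : plus_pow M D 0 x.
Proof.
apply: sub_gen_smallest; exists (fun=> 0), x; split; first by case.
by rewrite big_ord0 scale1r.
Qed.

Lemma plus_powS_sub D n : is_cartier_subalgebra iota G D ->
  plus_pow M D n.+1 `<=` plus_span D (plus_pow M D n).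
Proof.
move=> hD; apply: plus_pow_min; first exact: plus_span_submod.
move=> phi m hphi; rewrite big_ord_recl -scalerA; apply: plus_span_incl => //.
by apply: sub_gen_smallest; exists (fun i => phi (lift ord0 i)), m.
Qed.

Lemma plus_powS D n phi x : is_cartier_subalgebra iota G D ->
  alg_plus D phi -> plus_pow M D n x -> plus_pow M D n.+1 (phi *: x).
Proof.
move=> hD + hx; move: phi.
have [[S0 SB] SM] := plus_pow_submod D n.+1.
(* The quantifier over phi belongs to the induction predicate: acting by c on the element replaces
   phi by phi c. *)
suff : plus_pow M D n `<=` [set x | forall phi, alg_plus D phi ->
    plus_pow M D n.+1 (phi *: x)] by apply.
apply: plus_pow_min.
  split; first split.
  - by move=> phi _; rewrite scaler0.
  - by move=> y z hy hz phi hphi; rewrite scalerBr; apply: SB;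
      [apply: hy|apply: hz].
  - move=> c y hc hy phi hphi; rewrite scalerA; apply: hy.
    by have [] := alg_total_mulr_plus hD hc hphi.
move=> f m hf phi hphi; apply: sub_gen_smallest.
exists (fun i => if unlift ord0 i is Some j then f j else phi), m; split.
  by move=> i; case: unlift.
rewrite big_ord_recl unlift_none scalerA; congr (_ * _ *: _).
by apply: eq_bigr => i _; rewrite liftK.
Qed.

Lemma plus_pow_homo D D' n : (forall e, D e `<=` D' e) ->
  plus_pow M D n `<=` plus_pow M D' n.
Proof.
move=> DD'; apply: plus_pow_min.
  apply: is_submodP; first by case: (plus_pow_submod D' n).
  move=> e c x /DD' Dc; have [_] := plus_pow_submod D' n; apply.
  exact: alg_total_incl Dc.
move=> phi m hphi; apply: sub_gen_smallest; exists phi, m; split=> // i.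
move: (phi i) (hphi i); apply: smallest_sub; first exact: alg_plus_subgroup.
by move=> c [e e1 /DD']; apply: alg_plus_incl.
Qed.

Definition stable D :=
  exists n, forall n', (n <= n')%N -> plus_pow M D n' = plus_pow M D n.

Lemma underline_unstable D : ~ stable D -> underline M D = set0.
Proof. by move=> nD; apply/seteqP; split=> // x [n hn _]; apply: nD;
  exists n. Qed.

Lemma underline_stable D : stable D ->
  exists n, forall n', (n <= n')%N -> underline M D = plus_pow M D n'.
Proof. by move=> [n hn]; exists n => n' /hn ->; apply: underlineE. Qed.

Lemma underline_F_pure D : is_cartier_subalgebra iota G D -> stable D ->
  F_pure D (underline M D).
Proof.
move=> hD /underline_stable[n hn]; rewrite (hn n) //.
split; first exact: plus_pow_submod.
by rewrite -{1}(hn n) // (hn n.+1) //; apply: plus_powS_sub.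
Qed.

(** The empty default of [underline] has empty support, so no generic point imposes a condition and
    the zero submodule qualifies. *)
Lemma test_module_unstable D N : ~ stable D -> is_test_module iota D N ->
  N = [set 0].
Proof.
move=> nD [[[N0 NB] aN] _ Nmin]; apply/seteqP; split; last by move=> _ ->.
apply: Nmin; first split; first split=> //.
- by move=> x y -> ->; rewrite subr0.
- by move=> c x _ ->; rewrite scaler0.
move=> Y eta; rewrite underline_unstable // => -[Ysub [[P /Ysub]]].
by move=> [_ [u [_ [x [s []]]]]].
Qed.

Lemma generically_equalP D N :
    is_cartier_subalgebra iota G D -> stable D -> is_submod D N ->
  generically_equal iota D N <-> forall Y eta,
    irreducible_component (module_support iota (underline M D)) Y ->
    generic_point Y eta ->
    saturation iota eta N = saturation iota eta (underline M D).
Proof.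
move=> hD hst hN; have [hU _] := underline_F_pure hD hst.
by split=> h Y eta hY hYeta; have /generic_pointE[heta _] := hYeta;
  apply/localize_eqP; rewrite ?(h Y eta) //; apply: (is_submod_ract hD).
Qed.

(* D_+ N has the same localization as N at every generic point of the support,
   so the minimality of the test module N forces D_+ N = N. *)
Lemma test_module_F_pure D N : is_cartier_subalgebra iota G D -> stable D ->
  is_test_module iota D N -> F_pure D N.
Proof.
move=> hD hst [hN hgen Nmin]; split=> //; apply: Nmin;
  first exact: plus_span_submod.
have hS := plus_span_submod N hD; have aS := is_submod_ract hD hS.
have aN := is_submod_ract hD hN.
apply/(generically_equalP hD hst hS) => Y eta hY hYeta.
have E := (generically_equalP hD hst hN).1 hgen _ _ hY hYeta.
have /generic_pointE[heta _] := hYeta.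
apply/seteqP; split; first by rewrite -E; apply: saturationS;
  apply: plus_span_sub.
move=> x [w etaw Uwx]; suff : saturation iota eta (plus_span D N) (ract iota w
  x).
  move=> [v etav Nvwx]; exists (v * w); first exact: prime_notM.
  by rewrite (actM (action_ract iota M)).
(* Since U = D_+ U, it is enough to treat phi y with y in U; some multiple w y lies in N because N
   and U agree at eta. *)
have [hU Upure] := underline_F_pure hD hst.
move: (ract iota w x) (Upure _ Uwx) => z {x w etaw Uwx}; move: z.
apply: plus_span_min.
  split; first by apply: sub_saturation => //; case: hS => -[].
  move=> x y [v etav hx] [w etaw hy]; exists (v * w); first exact: prime_notM.
  rewrite (actB (action_ract iota M)); apply: (subgroupB aS.1).
    by rewrite mulrC (actM (action_ract iota M)); case: aS => _; apply.
  by rewrite (actM (action_ract iota M)); case: aS => _; apply.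
move=> e phi y e1 Dphi Uy.
have : saturation iota eta (underline M D) y by apply: sub_saturation.
rewrite -E => -[w etaw Nwy]; exists w => //.
rewrite (ract_scale _ _ (subalgebra_sub hD Dphi)).
apply: plus_span_incl; first exact: alg_plus_incl Dphi.
(* Of the p^e factors w, one brings y into N and the others keep it there. *)
rewrite -(@prednK (p ^ e)) ?expn_gt0 ?p_gt0 //.
by rewrite exprSr (actM (action_ract iota M)); case: aN => _; apply.
Qed.

End Subalgebras.

(** * The algebras C^(a^t) and their dependence on t *)

Section Twists.
Context {RR : realType} {p : nat} {R : comPzRingType} {C : pzRingType}.
Context {iota : {rmorphism R -> C}} {G : nat -> set C}.
Hypothesis (p_gt1 : (1 < p)%N) (hC : is_cartier_algebra p iota G).
Context {M : lmodType C} {a : set R}.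
Hypothesis ideal_a : is_ideal a.
Implicit Types (t : RR) (N : set M) (eta : set R).

Notation twist_a := (twist p iota G a).
Let p_gt0 : (0 < p)%N := ltnW p_gt1.

Lemma twist_incl t e phi r : G e phi -> ideal_pow a (twist_exp p t e) r ->
  twist_a t e (phi * iota r).
Proof. by move=> Gphi hr; apply: sub_gen_smallest; exists phi => //;
  exists r. Qed.

Lemma twist_min t e (Q : set C) : is_subgroup Q ->
  (forall phi r, G e phi -> ideal_pow a (twist_exp p t e) r -> Q (phi * iota
    r)) ->
  twist_a t e `<=` Q.
Proof.
by move=> hQ h; apply: smallest_sub => // _ [phi hphi [r hr <-]]; apply: h.
Qed.

Lemma twist_cartier_subalgebra t : 0 <= t ->
  is_cartier_subalgebra iota G (twist_a t).
Proof.
move=> t0; have GS := cartier_grading hC.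
have T e : is_subgroup (twist_a t e) by apply: smallest_subgroup.
split=> //.
- move=> d e x y hx hy; suff : twist_a t d `<=` [set x | twist_a t (d + e)%N (x
    * y)].
    by apply.
  apply: twist_min => {x hx}.
    apply: (@preim_subgroup C C (fun x => x * y)) => // u v; exact: mulrBl.
  move=> phi r Gphi hr /=; move: y hy; apply: twist_min.
    apply: (@preim_subgroup C C (fun y => _ * y)) => // u v; exact: mulrBr.
  move=> psi s Gpsi hs /=.
  rewrite mulrA -(mulrA phi) (cartier_linear hC _ Gpsi) mulrA -mulrA -rmorphM.
  apply: twist_incl; first exact: (grading_mul GS).
  apply: (ideal_pow_anti (twist_expD d e t0 p_gt0)).
  by apply: ideal_powD => //; apply: ideal_powXn.
- move=> r; rewrite -[iota r]mul1r; apply: twist_incl.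
    exact: (grading_one GS).
  by rewrite twist_exp0; apply: ideal_pow0.
- move=> e; apply: twist_min; first exact: (grading_subgroup GS).
  move=> phi r Gphi _; rewrite -[e]addn0; apply: (grading_mul GS) => //.
  by rewrite (cartier_zero hC); exists r.
Qed.

Lemma twist_homo t t' e : 0 <= t -> t <= t' -> twist_a t' e `<=` twist_a t e.
Proof.
move=> t0 tt'; apply: twist_min; first exact: smallest_subgroup.
move=> phi r Gphi hr; apply: twist_incl => //.
by apply: ideal_pow_anti hr; apply: twist_exp_homo.
Qed.

Lemma underline_common t t' : @stable C M (twist_a t) -> @stable C M (twist_a
  t') ->
  exists n, underline M (twist_a t) = plus_pow M (twist_a t) n /\
            underline M (twist_a t') = plus_pow M (twist_a t') n.
Proof.
move=> /underline_stable[n hn] /underline_stable[n' hn'].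
by exists (maxn n n'); split; [apply: hn|apply: hn'];
  rewrite ?leq_maxl ?leq_maxr.
Qed.

Lemma underline_homo t t' : 0 <= t -> t <= t' ->
    @stable C M (twist_a t) -> @stable C M (twist_a t') ->
  underline M (twist_a t') `<=` underline M (twist_a t).
Proof.
move=> t0 tt' st st'; have [n [-> ->]] := underline_common st st'.
by apply: plus_pow_homo => e; apply: twist_homo.
Qed.

(** One power f^B with B >= t' works for every n: moved past a map of degree e it becomes f^(B p^e),
    of which B (p^e - 1) factors turn the map into one of C^(a^t') and B factors remain for the next
    map. *)
Lemma ract_plus_pow t t' f : 0 <= t -> 0 <= t' -> a f ->
  exists m, forall n x, plus_pow M (twist_a t) n x ->
    plus_pow M (twist_a t') n (ract iota (f ^+ m) x).
Proof.
move=> t0 t'0 af; have [B hB] : exists B : nat, t' <= B%:R.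
  by exists `|Num.ceil t'|%N; apply: absz_ceil_ge.
have hD := twist_cartier_subalgebra t0.
have hD' := twist_cartier_subalgebra t'0.
exists B; elim=> [|n IH] x; first by move=> _; apply: plus_pow0.
move/(plus_powS_sub hD); move: x; apply: plus_span_min.
  apply: (@preim_subgroup M M (ract iota (f ^+ B))).
    by move=> u v; rewrite (actB (action_ract iota M)).
  exact: (plus_pow_submod (M := M) (twist_a t') n.+1).1.
move=> e phi y e1 Dphi /IH hy /=.
have Gphi := subalgebra_sub hD Dphi.
rewrite (ract_scale hC _ _ Gphi) -exprM.
have le := twist_exp_le (p := p) e t'0 hB.
have -> : (B * p ^ e = twist_exp p t' e + (B * (p ^ e - 1) - twist_exp p t' e +
  B))%N.
  by rewrite addnA subnKC // -mulnSr -subSn ?subn1 ?expn_gt0 ?p_gt0.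
rewrite exprD exprD (actM (action_ract iota M)) /ract scalerA.
apply: (plus_powS hD').
  apply: (alg_plus_incl e1); apply: twist_incl => //; exact: ideal_powX.
by have [_ aP] := is_submod_ract hD' (plus_pow_submod (M := M) (twist_a t') n);
  rewrite rmorphM -scalerA; apply: aP.
Qed.

(* Otherwise a multiple u N of N_eta is killed by a, and then
   u N = u D_+ N lies in the sum of the D_e u^(p^e) a N, which vanishes. *)
Lemma minimal_support_not_ideal t N eta : 0 < t -> noetherian R ->
    finitely_generated iota N -> F_pure (twist_a t) N ->
    minimal_support iota N eta ->
  exists2 f, a f & ~ eta f.
Proof.
move=> t0 noethR fgN [hN Npure] Nmin.
have hD := twist_cartier_subalgebra (ltW t0).
have aN := is_submod_ract hD hN.
have heta : is_prime eta by case: Nmin => -[].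
have [u Qu hu] := minimal_support_colon noethR aN fgN Nmin.
apply: contrapT => hf; apply: Qu.
have aeta r : a r -> eta r.
  by move=> ar; apply: contrapT => etar; apply: hf; exists r.
apply: common_annihilator => // x /Npure; move: x.
pose K := [set x : M | exists2 w, ~ eta w & ract iota (w * u) x = 0].
have hK : is_subgroup K.
  split=> [|x y [v etav hv] [w etaw hw]].
    by exists 1; [case: heta|rewrite (actr0 (action_ract iota M))].
  exists (v * w); first exact: prime_notM.
  have act := action_ract iota M.
  by rewrite -mulrA (actB act) {1}mulrCA !(actM act _ (_ * u)) hv hw !(actr0
    act) subrr.
apply: (plus_span_min hK) => e phi y e1 + Ny; move: phi.
apply: twist_min; first exact: preim_scale_subgroup.
move=> phi r Gphi hr.
(* Here t > 0 enters: in degree e >= 1 the exponent of a is positive. *)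
have ar : a r by apply: (ideal_pow_sub ideal_a _ hr); apply: twist_exp_gt0.
have [w etaw hw] := hu r (aeta _ ar).
exists w => //; rewrite -scalerA (ract_scale hC _ _ Gphi) -[iota r *: y]/(ract
  iota r y).
rewrite -(actM (action_ract iota M)) -(@prednK (p ^ e)) ?expn_gt0 ?p_gt0 //.
rewrite exprSr -!mulrA (mulrC u r) (actM (action_ract iota M)) hw //.
by rewrite (actr0 (action_ract iota M)) scaler0.
Qed.

(* Away from a, all the modules underline M (twist_a t) agree, and by
   minimal_support_not_ideal the generic points of their supports are away
   from a when t > 0. *)
Lemma test_module_homo t t' N N' : 0 < t -> t <= t' -> noetherian R ->
    (forall Q : set M, act_closed (ract iota) Q -> finitely_generated iota Q) ->
    @stable C M (twist_a t) -> @stable C M (twist_a t') ->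
    is_test_module iota (twist_a t) N -> is_test_module iota (twist_a t') N' ->
  N' `<=` N.
Proof.
move=> t0 tt' noethR fg st st' [hN Ngen _] [_ _ N'min].
have t'0 := lt_le_trans t0 tt'.
have hD := twist_cartier_subalgebra (ltW t0).
have hD' := twist_cartier_subalgebra (ltW t'0).
have hN' : is_submod (twist_a t') N.
  apply: is_submodP; first by case: hN.
  move=> e c x /(twist_homo (ltW t0) tt') Dc; case: hN => _; apply.
  exact: alg_total_incl Dc.
(* N is also a submodule for the smaller algebra at t', so by minimality of N' only its
   localizations at the generic points for t' remain to be checked. *)
apply: N'min => //; apply/(generically_equalP hD' st' hN') => Y eta hY hYeta.
have pure := underline_F_pure hD st.
have pure' := underline_F_pure hD' st'.
have aU := is_submod_ract hD pure.1; have aU' := is_submod_ract hD' pure'.1.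
have etamin := component_minimal hY hYeta aU'.
have [f af etaf] := minimal_support_not_ideal t'0 noethR (fg _ aU') pure'
  etamin.
have UU' := underline_homo (ltW t0) tt' st st'.
have [m hm] : exists m, forall x, underline M (twist_a t) x ->
    underline M (twist_a t') (ract iota (f ^+ m) x).
  have [m hm] := ract_plus_pow (ltW t0) (ltW t'0) af; exists m.
  by have [n [-> ->]] := underline_common st st'; apply: hm.
have notX P : is_prime P -> P `<=` eta -> ~ P (f ^+ m).
  by move=> hP Peta; apply: prime_notX => // /Peta.
have heta : is_prime eta by case: etamin => -[].
(* A prime below eta does not contain f, and multiplication by f^m maps the module at t into the one
   at t'; hence below eta both supports have the same primes. *)
have etamin' : minimal_support iota (underline M (twist_a t)) eta.
  split; first exact: (module_supportS aU' aU UU' etamin.1).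
  move=> P PU Peta; apply: (etamin.2 P) => //; move: PU.
  rewrite !module_supportE // => -[hP [x Ux hx]]; split=> //.
  exists (ract iota (f ^+ m) x); first exact: hm.
  move=> w Pw; rewrite -(actM (action_ract iota M)); apply: hx.
  by apply: prime_notM => //; apply: notX.
have [Y' hY' hY'eta] := minimal_component aU (fg _ aU) etamin'.
rewrite ((generically_equalP hD st hN).1 Ngen _ _ hY' hY'eta).
apply/seteqP; split; last exact: saturationS.
move=> x [w etaw Ux]; exists (f ^+ m * w).
  by apply: prime_notM => //; apply: notX.
by rewrite (actM (action_ract iota M)); apply: hm.
Qed.

End Twists.

(** * Polynomials with bounded exponents *)

Section Boxes.
Context {k : fieldType} {n : nat}.
Implicit Types (f g : mpoly n k) (Q : set (mpoly n k)).

Lemma box_le d d' f : (d <= d')%N -> box d f -> box d' f.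
Proof. by move=> dd' hf m /hf hm; apply: leq_trans dd'. Qed.

Lemma box_exhaust f : exists d, box d f.
Proof.
exists (\max_(m <- msupp f) \max_(j < n) m j)%N => m mf.
by rewrite (big_rem m mf) /= leq_maxl.
Qed.

Lemma boxM d d' f g : box d f -> box d' g -> box (d + d') (f * g).
Proof.
move=> hf hg m /msuppM_le /allpairsP[[m1 m2] /= [/hf h1 /hg h2 ->]].
apply/bigmax_leqP => j _; rewrite mnmDE leq_add //.
  exact: leq_trans (leq_bigmax j) h1.
exact: leq_trans (leq_bigmax j) h2.
Qed.

(** Monomial by monomial, divide the exponents by q with remainder; the quotients give s, and the
    remainders together with the coefficient give u. *)
Lemma mpoly_frobenius_ind q Q f : (0 < q)%N -> is_subgroup Q ->
  (forall s u, box q.-1 u -> Q (s ^+ q * u)) -> Q f.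
Proof.
move=> q0 hQ h; rewrite [f]mpolyE; apply: subgroup_sum => // m _.
pose m1 : multinom n := Multinom [tuple (m i %/ q)%N | i < n].
pose m2 : multinom n := Multinom [tuple (m i %% q)%N | i < n].
have -> : m = mnm_add (mnm_muln m1 q) m2.
  by apply/mnmP => i; rewrite mnmDE mulmnE !mnmE -divn_eq.
rewrite mpolyXD -mpolyXn scalerAr; apply: h => m'.
move=> /msuppZ_le; rewrite msuppX inE => /eqP ->.
by apply/bigmax_leqP => j _; rewrite mnmE -ltnS prednK // ltn_mod.
Qed.

End Boxes.

(** Replaces division by p^e by halving, so that one recursion on B covers all degrees e >= 1. *)
Lemma prime_power_half p e B : (1 < p)%N -> (1 <= e)%N ->
  (B %/ p ^ e <= B %/ 2)%N.
Proof.
move=> p1 e1; apply: leq_div2l => //; apply: (leq_trans p1).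
by rewrite -{1}[p]expn1 leq_exp2l // (leq_ltn_trans _ p1).
Qed.

(** * Lowering the gauge of generators *)

Section Gauges.
Context {RR : realType} {p : nat} {k : fieldType} {n : nat}.
Context {R : comPzRingType} {C : pzRingType}.
Context { pi : {rmorphism mpoly n k -> R}} {iota : {rmorphism R -> C}}.
Context {G : nat -> set C}.
Context {M : lmodType C} {l : nat} {g : 'I_l -> M}.
Hypothesis (p_gt1 : (1 < p)%N) (pi_surj : range pi = [set: R]).
Hypothesis (hC : is_cartier_algebra p iota G).

Let level (d : nat) : set M := gauge_level pi iota g (Some d).

Lemma level_le d d' : (d <= d')%N -> level d `<=` level d'.
Proof.
by move=> dd' m [f [hf ->]]; exists f; split=> // i; apply: box_le (hf i).
Qed.

Lemma level0 d : level d 0.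
Proof.
exists (fun=> 0); split; first by move=> i m; rewrite msupp0.
by rewrite big1 // => i _; rewrite !rmorph0 scale0r.
Qed.

Lemma levelM d d' u x : box d' u -> level d x ->
  level (d + d') (ract iota (pi u) x).
Proof.
move=> hu [f [hf ->]]; exists (fun i => u * f i); split.
  by move=> i; rewrite addnC; apply: boxM.
rewrite /ract scaler_sumr; apply: eq_bigr => i _.
by rewrite scalerA !rmorphM.
Qed.

(** Products of m elements of s lift to polynomials of exponents at most c m. Membership in a^m is
    recorded too, since it is needed to form elements of the twisted algebra. *)
Lemma ideal_pow_box (a : set R) (s : seq R) c m :
    a = act_span *%R [set r | r \in s] ->
    (forall r, r \in s -> exists2 u, box c u & pi u = r) ->
  ideal_pow a m `<=` act_span *%R
    [set r | ideal_pow a m r /\ exists2 u, box (c * m) u & pi u = r].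
Proof.
move=> aE hs; have spanI (A : set R) : is_ideal (act_span *%R A) by apply:
  act_span_closed.
elim: m => [|m IH].
  move=> r _; have [_ hM] := spanI [set r | ideal_pow a 0 r /\
    exists2 u, box (c * 0) u & pi u = r].
  rewrite -[r]mulr1; apply: hM; apply: act_span_incl; split.
    exact: ideal_pow0.
  exists 1; last exact: rmorph1.
  move=> m; rewrite muln0 msupp1 inE => /eqP ->.
  by apply/bigmax_leqP => j _; rewrite mnm0E.
set S := act_span _ _; have hS : is_ideal S := spanI _.
apply: ideal_pow_min => // f hf; rewrite big_ord_recl.
have : a (f ord0) by [].
have : ideal_pow a m (\prod_(i < m) f (lift ord0 i)) by apply: ideal_pow_prod.
move: (f ord0) (\prod_(i < m) f (lift ord0 i)) => b w {f hf} hw.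
rewrite aE; move: b; apply: act_span_min; first exact: colon_ideal.
move=> b bs; rewrite /= mulrC; move/IH: hw; move: w.
apply: act_span_min; first exact: colon_ideal.
move=> w [hw [u hu uE]]; have [v hv vE] := hs b bs.
rewrite /= mulrC; apply: act_span_incl; split.
  rewrite -add1n; apply: ideal_powD => //; rewrite -[b]expr1.
  by apply: ideal_powX; rewrite aE; apply: act_span_incl.
exists (v * u); first by rewrite mulnS; apply: boxM.
by rewrite rmorphM uE vE.
Qed.

Section Bounded.
Context {J : Type} {e : J -> nat} {psi : J -> C} {K : nat}.
Hypothesis psi_homog : forall i, (1 <= e i)%N /\ G (e i) (psi i).
Hypothesis psi_gen : forall c, alg_plus G c ->
  exists s : seq (J * R), c = \sum_(x <- s) psi x.1 * iota x.2.
Hypothesis psi_bound : forall i d x, level d x ->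
  level (d %/ p ^ e i + K) (psi i *: x).

Lemma iota_G r : G 0%N (iota r).
Proof. by rewrite (cartier_zero hC); exists r. Qed.

Lemma psi_gen_homog d phi : (1 <= d)%N -> G d phi ->
  exists s : seq (J * R),
    phi = \sum_(x <- s | e x.1 == d) psi x.1 * iota x.2.
Proof.
move=> d1 Gphi; have GS := cartier_grading hC.
have [s sE] := psi_gen (alg_plus_incl d1 Gphi); exists s.
rewrite big_tnth in sE; rewrite big_tnth;
  move: (size s) (tnth (in_tuple s)) sE => q x sE.
(* The degree j part of the relation [sE], with phi moved to the other side; N exceeds d and all
   degrees that occur, so these parts sum to zero and directness applies. *)
pose F j := \sum_(i < q | e (x i).1 == j) psi (x i).1 * iota (x i).2 -
  (if j == d then phi else 0).
pose N := (d + \max_(i < q) e (x i).1).+1.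
have GF j : G j (F j).
  have Gj := grading_subgroup GS j; apply: (subgroupB Gj).
    apply: subgroup_sum => // i /eqP <-; rewrite -[e _]addn0.
    by apply: (grading_mul GS); [case: (psi_homog (x i).1)|apply: iota_G].
  by case: eqP => [->//|_]; case: Gj.
have dN : (d < N)%N by rewrite ltnS leq_addr.
suff /(grading_direct GS GF) /(_ d dN) : \sum_(j < N) F j = 0.
  by rewrite /F eqxx => /eqP; rewrite subr_eq0 => /eqP.
have phiE : \sum_(j < N) (if j == d :> nat then phi else 0) = phi.
  by rewrite -big_mkcond (big_pred1 (Ordinal dN)).
rewrite /F sumrB phiE; apply/eqP; rewrite subr_eq0; apply/eqP; rewrite [RHS]sE.
rewrite (exchange_big_dep predT) //=; apply: eq_bigr => i _.
have xN : (e (x i).1 < N)%N.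
  by rewrite ltnS (leq_trans _ (leq_addl _ _)) // (leq_bigmax i).
by rewrite (big_pred1 (Ordinal xN)).
Qed.

Section TwistGeneration.
Context {a : set R} {s : seq R} {c : nat}.
Hypothesis aE : a = act_span *%R [set r | r \in s].
Hypothesis s_box : forall r, r \in s -> exists2 u, box c u & pi u = r.

(** All coefficients are collected to the right of [psi i], where their product lies in a power of a
    and splits into generators u of low gauge and arbitrary factors r. *)
Lemma twist_gen (t : RR) d (Q : set C) : (1 <= d)%N -> is_subgroup Q ->
    (forall i u r, e i = d -> box (c * twist_exp p t d) u ->
       ideal_pow a (twist_exp p t d) (pi u) ->
       Q (psi i * iota (pi u) * iota r)) ->
  twist p iota G a t d `<=` Q.
Proof.
move=> d1 hQ h; apply: twist_min => // phi r /(psi_gen_homog d1)[w ->] hr.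
rewrite big_distrl /=; apply: subgroup_sum => // -[i r'] /= /eqP ei.
rewrite -mulrA -rmorphM.
have := @ideal_Mr _ _ r r' (ideal_pow_ideal (a := a) (twist_exp p t d)) hr.
rewrite mulrC => /(ideal_pow_box aE s_box) => hx.
suff : act_span *%R [set r | ideal_pow a (twist_exp p t d) r /\
    exists2 u, box (c * twist_exp p t d) u & pi u = r] `<=`
    (* Quantifying over v makes this set an ideal. *)
    [set r | forall v, Q (psi i * iota (r * v))].
  by move=> /(_ _ hx 1); rewrite mulr1.
apply: act_span_min; first split; first split.
- by move=> v; rewrite mul0r rmorph0 mulr0; case: hQ.
- by move=> x y hx' hy v; rewrite mulrBl rmorphB mulrBr; apply: (subgroupB hQ).
- by move=> v x hx' v'; rewrite mulrAC mulrC; apply: hx'.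
move=> x [hpow [u hu uE]] v; rewrite rmorphM mulrA -uE; apply: h => //.
by rewrite uE.
Qed.

(** After h s^(p^d) = s h, [psi i] is applied to an element of gauge at most B + (p^d - 1) + c T1
    (p^d - 1). Division by p^d leaves at most B/2 + 1 + c T1, and K is added by [psi_bound]. *)
Lemma F_pure_descent (t : RR) T1 (N : set M) B : 0 <= t -> t <= T1%:R ->
    F_pure (twist p iota G a t) N ->
    N `<=` act_span (ract iota) (N `&` level B) ->
  N `<=` act_span (ract iota) (N `&` level (B %/ 2 + (1 + c * T1 + K))).
Proof.
move=> t0 tT [hN Npure] hB.
have hD := twist_cartier_subalgebra (a := a) p_gt1 hC t0.
have aN := is_submod_ract hD hN.
set A := N `&` level _; have hS := act_span_closed (act := ract iota) A.
have [hS1 hSM] := hS.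
apply: (subset_trans Npure); apply: (plus_span_min hS1) => d + y d1 + Ny.
move=> phi; move: phi; apply: (twist_gen d1).
  exact: preim_scale_subgroup.
move=> i u r ei hu upow.
set h := psi i * iota (pi u).
have Gh : G d h.
  rewrite -[d]addn0 -ei; apply: (grading_mul (cartier_grading hC)).
    by case: (psi_homog i).
  exact: iota_G.
have Dh : twist p iota G a t d h.
  by apply: twist_incl => //; rewrite -ei; case: (psi_homog i).
(* With r inside the condition, the set of good y is closed under R, so y may be taken among the
   generators of gauge at most B. *)
suff : act_span (ract iota) (N `&` level B) `<=`
    [set y | forall r, act_span (ract iota) A (h *: ract iota r y)].
  by move=> /(_ _ (hB _ Ny) r); rewrite /= scalerA.
apply: act_span_min.
  split; first split.
  - move=> v; rewrite (actr0 (action_ract iota M)) scaler0; exact: hS1.1.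
  - move=> x z hx hz v; rewrite (actB (action_ract iota M)) scalerBr.
    by apply: (subgroupB hS1).
  - by move=> v x hx v'; rewrite -(actM (action_ract iota M)).
move=> x [Nx lx] v.
have [f _ <-] : range pi v by rewrite pi_surj.
have q0 : (0 < p ^ d)%N by rewrite expn_gt0 (ltnW p_gt1).
apply: (mpoly_frobenius_ind (Q := [set f | act_span (ract iota) A
    (h *: ract iota (pi f) x)]) f q0).
  apply: (@preim_subgroup _ M (fun f => h *: ract iota (pi f) x)) => //.
  by move=> b b'; rewrite rmorphB (actBl (action_ract iota M)) scalerBr.
move=> b w hw /=; rewrite rmorphM rmorphXn (actM (action_ract iota M)).
rewrite -(ract_scale hC _ _ Gh); apply: hSM; apply: act_span_incl; split.
  case: (hN) => _; apply; first exact: alg_total_incl Dh.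
  by case: aN => _; apply.
rewrite /h -scalerA.
have := psi_bound i (levelM hu (levelM hw lx)); rewrite ei.
apply: level_le; rewrite addnA leq_add2r.
apply: (@leq_trans ((B + (1 + c * T1) * p ^ d) %/ p ^ d)); last first.
  by rewrite [(B + _)%N]addnC divnMDl // addnC leq_add2r prime_power_half.
apply: leq_div2r; rewrite -addnA leq_add2l mulnDl mul1n leq_add //.
  by rewrite leq_pred.
rewrite -mulnA leq_mul2l; apply/orP; right.
apply: leq_trans (twist_exp_le d t0 tT) _.
by rewrite leq_mul2l leq_subr orbT.
Qed.

(** As long as B > 2 K3, the new bound B/2 + K3 is strictly smaller than B, so the descent reaches 2
    K3 whatever the initial B. *)
Lemma F_pure_bounded (t : RR) T1 (N : set M) : 0 <= t -> t <= T1%:R ->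
    F_pure (twist p iota G a t) N ->
    (exists B, N `<=` act_span (ract iota) (N `&` level B)) ->
  N `<=` act_span (ract iota) (N `&` level (2 * (1 + c * T1 + K))).
Proof.
move=> t0 tT Npure [B]; set K3 := (1 + c * T1 + K)%N.
elim/ltn_ind: B => B IH hB; have [BK|KB] := leqP B (2 * K3).
  apply: (subset_trans hB); apply: act_spanS => x [Nx lx].
  by split=> //; apply: (level_le BK).
apply: (IH _ _ (F_pure_descent t0 tT Npure hB)); rewrite -/K3.
rewrite -(@ltn_pmul2r 2) // mulnDl (mulnC K3) [ltnRHS]muln2 -addnn.
by rewrite -addnS leq_add // leq_trunc_div.
Qed.

End TwistGeneration.

End Bounded.

End Gauges.

(** * Levels as finite-dimensional spaces, and chains of submodules *)

Section Levels.
Context {k : fieldType} {n : nat} {R : comPzRingType} {C : pzRingType}.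
Context { pi : {rmorphism mpoly n k -> R}} {iota : {rmorphism R -> C}}.
Context {M : lmodType C} {l : nat} {g : 'I_l -> M}.

Let level (d : nat) : set M := gauge_level pi iota g (Some d).

Lemma level_exhaust x : range pi = [set: R] ->
    (exists r : 'I_l -> R, x = \sum_(i < l) iota (r i) *: g i) ->
  exists d, level d x.
Proof.
move=> pi_surj [r ->].
have /choice[f hf] (i : 'I_l) : exists u, pi u = r i.
  by have [u _ <-] : range pi (r i) by [rewrite pi_surj]; exists u.
have /choice[d hd] (i : 'I_l) : exists d, box d (f i) by apply: box_exhaust.
exists (\max_i d i)%N, f; split; last by apply: eq_bigr => i _; rewrite hf.
by move=> i; apply: box_le (hd i); apply: leq_bigmax.
Qed.

Lemma finitely_generated_level (N : set M) : (forall x, exists d, level d x) ->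
  finitely_generated iota N ->
  exists B, N `<=` act_span (ract iota) (N `&` level B).
Proof.
move=> hl [s sN Ns].
have [B hB] : exists B, [set x | x \in s] `<=` level B.
  elim: s {sN Ns} => [|x s [B hB]]; first by exists 0%N.
  have [d hd] := hl x; exists (maxn d B) => y;
    rewrite /= inE => /orP[/eqP ->|ys].
    by apply: level_le hd; rewrite leq_maxl.
  by apply: (level_le (leq_maxr d B)); apply: hB.
exists B; apply: (subset_trans Ns); apply: act_spanS => x xs.
by split; [apply: sN|apply: hB].
Qed.

Lemma gauge_level_bound (RR : realType) p (delta : M -> option nat) (J : Type)
    (e : J -> nat) (psi : J -> C) (K : RR) : (0 < p)%N ->
    is_gauge RR pi iota g delta ->
    (forall i m, (degR RR (delta (psi i *: m)) <=
       degR RR (delta m) * ((p ^ e i)%:R^-1)%:E + (K / (p.-1)%:R)%:E)%E) ->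
  exists K' : nat, forall i d x, level d x -> level (d %/ p ^ e i + K') (psi i
    *: x).
Proof.
move=> p0 hdelta hpsi; set K1 := K / _ in hpsi.
(* The absolute value covers a negative K, and the successor the rounding in [d %/ p ^ e i]. *)
exists `|Num.ceil `|K1| |.+1 => i d x lx.
have q0 : (0 < p ^ e i)%N by rewrite expn_gt0 p0.
have [hx /(_ (Some d) lx)] := hdelta x.
have [+ _] := hdelta (psi i *: x); have := hpsi i x.
case: (delta (psi i *: x)) => [d1|]; last by move=> _ /= -> _; apply: level0.
(* For x of gauge -oo the bound would force [psi i *: x] to have gauge -oo as well, against the
   finite d1. *)
case: (delta x) => [d0|] /=; last first.
  by rewrite gt0_mulNye ?lte_fin ?invr_gt0 ?ltr0n //= leeNy_eq.
rewrite -EFinM -EFinD !lee_fin ler_nat => h l1 d0d.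
apply: level_le l1; rewrite -(ler_nat RR).
apply: (le_trans h); rewrite addnS -addSn natrD; apply: lerD; last first.
  by apply: (le_trans (ler_norm K1)); apply: absz_ceil_ge.
rewrite ler_pdivrMr ?ltr0n // -natrM ler_nat.
by apply: (leq_trans d0d); rewrite ltnW // ltn_ceil.
Qed.

Definition const_act (c : k) (x : M) : M := ract iota (pi (mpolyC n c)) x.

Lemma action_const : is_action const_act.
Proof.
have act := action_ract iota M; split=> *; rewrite /const_act.
- exact: (actB act).
- by rewrite mpolyCB rmorphB (actBl act).
- by rewrite mpolyCM rmorphM (actM act).
- by rewrite mpolyC1 rmorph1 (act1 act).
Qed.

Definition box_monomial D (b : {ffun 'I_n -> 'I_D.+1}) : mpoly n k :=
  mpolyX k (Multinom [tuple (b i : nat) | i < n]).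

Definition level_basis D : seq M :=
  [seq ract iota (pi (box_monomial x.2)) (g x.1) |
    x <- enum {: 'I_l * {ffun 'I_n -> 'I_D.+1}}].

Lemma level_span D :
  level D `<=` act_span const_act [set x | x \in level_basis D].
Proof.
move=> _ [f [hf ->]]; set S := act_span _ _.
have [hS hSM] : act_closed const_act S by apply: act_span_closed.
apply: (@subgroup_sum _ _ _ _ _ S) => // i _; rewrite [f i]mpolyE rmorph_sum.
rewrite rmorph_sum scaler_suml big_seq;
  apply: (@subgroup_sum _ _ _ _ _ S) => // m mf.
rewrite -mul_mpolyC !rmorphM -scalerA; apply: hSM; apply: act_span_incl => /=.
apply/mapP; exists (i, [ffun j => inord (m j)]); first by rewrite mem_enum.
rewrite /ract /box_monomial /=; congr (iota (pi (mpolyX k _)) *: _).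
apply/mnmP => j; rewrite mnmE ffunE inordK // ltnS.
exact: leq_trans (leq_bigmax j) (hf i m mf).
Qed.

(* Each N is determined by the k-subspace of coefficient vectors of elements
   of N in terms of level_basis D, and comparable subspaces of equal dimension
   are equal. *)
Lemma finite_chain_of_submodules D (F : set (set M)) :
    (forall N, F N -> act_closed (ract iota) N /\
       N `<=` act_span (ract iota) (N `&` level D)) ->
    (forall N N', F N -> F N' -> N `<=` N' \/ N' `<=` N) ->
  finite_set F.
Proof.
move=> hF chainF; set b := level_basis D; set q := size b.
pose ev (v : 'rV[k]_q) : M := \sum_(j < q) const_act (v 0 j) (nth 0 b j).
have act := action_const.
have evB u v : ev (u - v) = ev u - ev v.
  by rewrite /ev -sumrB; apply: eq_bigr => j _; rewrite !mxE (actBl act).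
have evZ c v : ev (c *: v) = const_act c (ev v).
  rewrite /ev /const_act /ract scaler_sumr; apply: eq_bigr => j _.
  by rewrite mxE mpolyCM !rmorphM scalerA.
have level_ev x : level D x -> exists v, x = ev v.
  move/level_span; move: x; apply: act_span_min.
    split; first split.
    - by exists 0; have := evB 0 0; rewrite !subrr.
    - by move=> _ _ [u ->] [v ->]; exists (u - v); rewrite evB.
    - by move=> c _ [v ->]; exists (c *: v); rewrite evZ.
  move=> x /(nthP 0)[j jq <-]; exists (delta_mx 0 (Ordinal jq)).
  rewrite /ev (bigD1 (Ordinal jq)) //= mxE !eqxx (act1 act) big1 ?addr0 //.
  by move=> i ij; rewrite mxE (negPf ij) andbF (act0r act).
have coeffs N : exists U : {vspace 'rV[k]_q}, act_closed (ract iota) N ->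
    forall v, v \in U <-> N (ev v).
  have [aN|] := pselect (act_closed (ract iota) N); last by exists 0%VS.
  pose W := [set v | N (ev v)].
  have hW : act_closed *:%R W.
    split; first by apply: preim_subgroup => //; case: aN.
    by move=> c v; rewrite /W /= evZ; case: aN => _; apply.
  (* W is only a set closed under the operations; a finite generating family turns it into a
     [vspace], which has a dimension. *)
  have [|s sW Ws] := @noetherian_submodule _ _ _ (vbasis {:'rV[k]_q}) W
      (@noetherian_field k) (action_scale _) hW.
    move=> v _; rewrite (coord_vbasis (memvf v)).
    have [hS hSM] := act_span_closed (act := *:%R)
      [set x | x \in (vbasis {:'rV[k]_q} : seq _)].
    apply: (@subgroup_sum _ _ _ _ _ (act_span _ _)) => // i _; apply: hSM.
    by apply: act_span_incl; apply: mem_nth; rewrite size_tuple.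
  exists <<s>>%VS => _ v; split=> [vs|/Ws].
    rewrite (coord_span (X := in_tuple s) vs).
    apply: (@subgroup_sum _ _ _ _ _ W) => [|i _]; first by case: hW.
    by case: hW => _; apply; apply: sW; rewrite /= mem_nth.
  move: v; apply: act_span_min; last by move=> v vs; apply: memv_span.
  split; first by split=> [|u v]; [apply: mem0v|apply: rpredB].
  by move=> c v; apply: rpredZ.
have [U hU] := choice coeffs.
have U_inj N N' : F N -> F N' -> \dim (U N) = \dim (U N') -> N `<=` N' -> N =
  N'.
  move=> FN FN' dimE NN'; apply/seteqP; split=> //.
  have [aN _] := hF _ FN; have [aN' gen'] := hF _ FN'.
  apply: (subset_trans gen'); apply: act_span_min => // x [N'x lx].
  have [v vE] := level_ev _ lx; rewrite vE; apply/(hU _ aN).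
  suff -> : U N = U N' by apply/(hU _ aN'); rewrite -vE.
  apply/eqP; rewrite eqEdim dimE leqnn andbT.
  by apply/subvP => w /(hU _ aN) /NN' /(hU _ aN').
(* One member of F per dimension between 0 and q; as F is a chain, a member is equal to the one
   picked for its dimension. *)
pose pick d := xget set0 [set N | F N /\ \dim (U N) = d].
apply: (@sub_finite_set _ _ [set pick d | d in `I_q.+1]); last first.
  by apply: finite_image; apply: finite_II.
move=> N FN; exists (\dim (U N)).
  by rewrite /= ltnS (leq_trans (dimvS (subvf _))) // dimvf dim_matrix mul1r.
have [Fp dimp] : [set N' | F N' /\ \dim (U N') = \dim (U N)] (pick (\dim (U
  N))).
  by apply: (xgetPex set0 (P := [set N' | _])); exists N.
have [NP|PN] := chainF _ _ FN Fp; last exact: U_inj _ _ Fp FN dimp PN.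
by apply/esym; apply: U_inj _ _ FN Fp (esym dimp) NP.
Qed.

End Levels.

(** * Finiteness of both families *)

Theorem theorem4p18 (RR : realType) (p : nat) (k : fieldType) (n : nat)
    (R : comPzRingType) (C : pzRingType)
    (pi : {rmorphism mpoly n k -> R}) (iota : {rmorphism R -> C})
    (G : nat -> set C) (M : lmodType C) (a : set R) (T : RR)
    (char_k : p \in [pchar k]) (Ffin_k : F_finite k p)
    (pi_surj : range pi = [set: R])
    (cartier_C : is_cartier_algebra p iota G)
    (coherent_M : coherent iota M)
    (bounded_M : gauge_bounded RR p pi iota G M)
    (ideal_a : is_ideal a) (T_gt0 : 0 < T) :
  finite_set [set test_module iota M (twist p iota G a t) |
               t in [set t : RR | 0 <= t <= T]] /\
  finite_set [set underline M (twist p iota G a t) |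
               t in [set t : RR | 0 <= t <= T]].
Proof.
have p_gt1 : (1 < p)%N by apply: prime_gt1; move/andP: char_k => [].
have [l [g [delta [M_gen delta_gauge [J [e [psi [K [psi_homog psi_gen
  psi_bound]]]]]]]]]
  := bounded_M.
have [K' psi_level] := gauge_level_bound (ltnW p_gt1) delta_gauge psi_bound.
have noethR : noetherian R := noetherian_surj pi_surj (noetherian_mpoly (n :=
  n)).
have act := action_ract iota M.
have fg (Q : set M) : act_closed (ract iota) Q -> finitely_generated iota Q.
  move=> hQ; have [|s] := @noetherian_submodule _ _ _ [seq g i | i <- enum
    'I_l] Q
    noethR act hQ; last by exists s.
  move=> x _; have [r ->] := M_gen x.
  set S := act_span _ _; have [hS hSM] : act_closed (ract iota) S.
    by apply: act_span_closed.
  apply: (@subgroup_sum _ _ _ _ _ S) => // i _; apply: hSM.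
  by apply: act_span_incl; apply: map_f; rewrite mem_enum.
have [s aE] := noethR _ ideal_a.
have [c s_box] : exists c, forall r, r \in s -> exists2 u : mpoly n k, box c u
  & pi u = r.
  elim: (s) => [|r s' [c hc]]; first by exists 0%N.
  have [u _ ur] : range pi r by rewrite pi_surj.
  have [d hd] := box_exhaust u; exists (maxn d c) => r'.
  rewrite inE => /orP[/eqP ->|/hc[v hv vr]].
    by exists u => //; apply: box_le hd; rewrite leq_maxl.
  by exists v => //; apply: box_le hv; rewrite leq_maxr.
pose D (t : RR) := twist p iota G a t.
pose good (t : RR) := [/\ 0 < t, t <= T & @stable C M (D t)].
pose T1 := `|Num.ceil T|%N.
pose B := (2 * (1 + c * T1 + K'))%N.
have hD t : good t -> is_cartier_subalgebra iota G (D t).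
  by case=> t0 _ _; apply: twist_cartier_subalgebra => //; apply: ltW.
have pure_gen t N : good t -> F_pure (D t) N -> act_closed (ract iota) N /\
    N `<=` act_span (ract iota) (N `&` gauge_level pi iota g (Some B)).
  move=> ht Npure; have [t0 tT _] := ht.
  have aN := is_submod_ract (hD t ht) Npure.1; split=> //.
  have tT1 : t <= T1%:R by apply: (le_trans tT); apply: absz_ceil_ge;
    apply: ltW.
  apply: (F_pure_bounded p_gt1 pi_surj cartier_C psi_homog psi_gen psi_level aE
    s_box
    (ltW t0) tT1 Npure).
  apply: finitely_generated_level; last exact: fg.
  by move=> x; apply: level_exhaust.
(* Shared by both families: P t N says that N is the member at t, and only F-purity and monotonicity
   in t are asked of it. *)
have chain (P : RR -> set M -> Prop) :
    (forall t N, good t -> P t N -> F_pure (D t) N) ->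
    (forall t t' N N', good t -> good t' -> t <= t' -> P t N -> P t' N' -> N'
      `<=` N) ->
    finite_set [set N | exists2 t, good t & P t N].
  move=> hpure hmono; apply: (finite_chain_of_submodules (D := B)).
    by move=> N [t ht PtN]; apply: (pure_gen t) => //; apply: hpure.
  move=> N N' [t ht PtN] [t' ht' PtN'].
  have [tt'|/ltW t't] := leP t t'; first by right; apply: (hmono t t').
  by left; apply: (hmono t' t).
split.
  (* The three exceptional values: t = 0, no test module, and a test module over a chain that does
     not stabilize. *)
  apply: (@sub_finite_set _ _ ([set test_module iota M (D 0); set0; [set 0]] `|`
    [set N | exists2 t, good t & is_test_module iota (D t) N])).
    move=> _ [t /= /andP[t0 tT] <-].
    have [->|tn0] := eqVneq t 0; first by left; left; left.
    have [[N hN]|nex] := pselect (exists N : set M, is_test_module iota (D t)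
      N); last first.
      left; left; right; apply/seteqP; split=> // x [N hN _].
      by exfalso; apply: nex; exists N.
    rewrite (test_moduleE hN).
    have [st|nst] := pselect (@stable C M (D t)).
      by right; exists t => //; split=> //; rewrite lt_def tn0.
    by left; right; apply: test_module_unstable nst hN.
  rewrite !finite_setU; split; first by do !split; apply: finite_set1.
  apply: (chain (fun t N => is_test_module iota (D t) N)).
    move=> t N ht hN; have [_ _ st] := ht.
    exact: (test_module_F_pure (ltnW p_gt1) cartier_C (hD t ht) st hN).
  move=> t t' N N' [t0 _ st] [_ _ st'] tt' hN hN'.
  exact: (test_module_homo p_gt1 cartier_C ideal_a t0 tt' noethR fg st st' hN
    hN').
apply: (@sub_finite_set _ _ ([set underline M (D 0); set0] `|`
  [set N | exists2 t, good t & N = underline M (D t)])).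
  move=> _ [t /= /andP[t0 tT] <-].
  have [->|tn0] := eqVneq t 0; first by left; left.
  have [st|nst] := pselect (@stable C M (D t)).
    by right; exists t => //; split=> //; rewrite lt_def tn0.
  by left; right; apply: underline_unstable.
rewrite !finite_setU; split; first by do !split; apply: finite_set1.
apply: (chain (fun t N => N = underline M (D t))).
  by move=> t N ht ->; apply: underline_F_pure (hD t ht) _; case: ht.
move=> t t' N N' [t0 _ st] [_ _ st'] tt' -> ->.
exact: (underline_homo (ltW t0) tt' st st').
Qed.
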